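(* Let $n$ and $k$ be nonnegative integers. The following five sets all have the same cardinality: (1) the set $\mathcal{T}_{n,k}$ of rooted trees $T$ on $[n+1]$ whose maximal decreasing subtree $\mathrm{MD}(T)$ has exactly $k+1$ vertices; (2) the set $\mathcal{A}_{n,k}$ of cycles $[T_0,T_1,\dots,T_k]$ of $k+1$ minimally rooted trees whose vertex sets form a partition of $[n+1]$; (3) the set $\mathcal{B}_{n,k}$ of ordered forests $(T_1,\dots,T_\ell,T_{\ell+1},\dots,T_{\ell+k})$ on $[n]$ (with $\ell\ge 0$) such that the last $k$ trees $T_{\ell+1},\dots,T_{\ell+k}$ are minimally rooted; (4) the set $\mathcal{C}_{n,k}$ of finite sequences $(\mathcal{F}_1,\dots,\mathcal{F}_h)$ of $k$-good ordered forests whose vertex sets form a partition of $[n]$; (5) the set $\mathcal{F}_{n,k}$ of rooted trees on $[n+1]$ in which $n+1$ is a leaf and each of $1,2,\dots,k$ is a nonleaf.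
   Context: $[m]=\{1,\dots,m\}$, $[0]=\emptyset$. A tree on a finite set $X$ is a connected acyclic graph with vertex set $X$; a rooted tree has a distinguished vertex, the root. In a rooted tree, the parent of a non-root vertex $v$ is the vertex preceding $v$ on the unique path from the root to $v$, and $v$ is a child of its parent; a leaf is a vertex with no children. A rooted tree is decreasing if every nonleaf is greater than all of its children. The maximal decreasing subtree $\mathrm{MD}(T)$ of a rooted tree $T$ is the maximal subtree of $T$ containing the root of $T$ (as its root) which is decreasing. A rooted tree is minimally rooted if its root has no child smaller than the root. An ordered forest on a finite set $X$ is a tuple of rooted trees whose vertex sets form a partition of $X$. A cycle $[a_0,\dots,a_k]$ is a sequence considered up to cyclic rotation. A vertex is called special if its label is at most $k$. An ordered forest $(T_0,T_1,\dots,T_\ell)$ is $k$-good if: when $\ell=0$, either $T_0$ consists of a single vertex which lies in $[k]$, or $T_0$ contains no vertex of $[k]$; when $\ell\ge1$, the trees $T_1,\dots,T_\ell$ are minimally rooted, and for each $i=0,1,\dots,\ell-1$ the number of vertices of $T_0,\dots,T_i$ lying in $[k]$ is at least $i+1$, while the number of vertices of $T_0,\dots,T_\ell$ lying in $[k]$ equals $\ell$.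
   Formalization: The hypothesis k ≤ n is added: for k > n the claim is false, since the sets (1), (2), (3) and (5) are then empty while the set (4) has n! elements (for n = 0, k = 1 it contains the empty sequence). *)

(* Defs.v *)
From mathcomp Require Import all_boot.
Set Implicit Arguments. Unset Strict Implicit. Unset Printing Implicit Defensive.

(* Vertices are elements of 'I_N; the label of a vertex is its value.
   [m] = {1,...,m} is represented by [iv m]. *)
Definition iv (N m : nat) : {set 'I_N} := [set i : 'I_N | (1 <= i) && (i <= m)].

(* A rooted tree on a vertex set V, encoded by V together with its parent map f :
   f maps each non-root vertex to its parent, fixes the root, and is the identity
   outside V (canonical encoding, so distinct pairs = distinct rooted trees). *)
Definition tree (N : nat) := ({set 'I_N} * {ffun 'I_N -> 'I_N})%type.

Definition is_rtree N (t : tree N) : bool :=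
  let: (V, f) := t in
  [forall x, (x \notin V) ==> (f x == x)] &&
  [forall x in V, f x \in V] &&
  [exists r in V, (f r == r) && [forall x in V, iter #|V| f x == r]].

Definition is_root N (t : tree N) (r : 'I_N) : bool := (r \in t.1) && (t.2 r == r).

Definition child N (t : tree N) (v x : 'I_N) : bool :=
  [&& x \in t.1, t.2 x == v & x != v].

Definition is_leaf N (t : tree N) (v : 'I_N) : bool := [forall x, ~~ child t v x].

Definition min_rooted N (t : tree N) : bool :=
  [forall r, is_root t r ==> [forall x, child t r x ==> (r < x)]].

(* S is (the vertex set of) a decreasing subtree of t containing the root of t:
   S contains the root, is closed under taking parents (so it is a connected
   subtree rooted at the root), and every nonleaf of it is greater than its
   children, i.e. every non-root vertex of S is smaller than its parent. *)
Definition decr_root_subtree N (t : tree N) (S : {set 'I_N}) : bool :=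
  [&& S \subset t.1,
      [exists r, is_root t r && (r \in S)],
      [forall x in S, t.2 x \in S] &
      [forall x in S, (t.2 x != x) ==> (x < t.2 x)]].

Definition MD_card N (t : tree N) (m : nat) : Prop :=
  exists2 S, maxset (decr_root_subtree t) S & #|S| = m.

Definition seq_partition N (Vs : seq {set 'I_N}) (X : {set 'I_N}) : bool :=
  [&& \bigcup_(V <- Vs) V == X,
      pairwise (fun A B : {set 'I_N} => [disjoint A & B]) Vs &
      set0 \notin Vs].

Definition ordered_forest_on N (X : {set 'I_N}) (F : seq (tree N)) : bool :=
  all (@is_rtree N) F && seq_partition [seq t.1 | t <- F] X.

Definition forest_vset N (F : seq (tree N)) : {set 'I_N} := \bigcup_(t <- F) t.1.

Definition nspecial N (k : nat) (F : seq (tree N)) (i : nat) : nat :=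
  #|\bigcup_(t <- take i.+1 F) t.1 :&: iv N k|.

Definition kgood N (k : nat) (F : seq (tree N)) : bool :=
  match F with
  | [::] => false
  | T0 :: rest =>
    let l := size rest in
    if l == 0 then
      [exists v, (T0.1 == [set v]) && (v \in iv N k)] || [disjoint T0.1 & iv N k]
    else
      [&& all (@min_rooted N) rest,
          [forall i : 'I_l, i.+1 <= nspecial k F i] &
          nspecial k F l == l]
  end.

Definition rot_equiv {T : eqType} (s t : seq T) : Prop := exists i, t = rot i s.

(* The set {x | P x}, taken modulo the equivalence R, is finite with exactly c
   classes: there is a list of c pairwise R-inequivalent representatives in P such
   that every element of P is equivalent to one of them.  With R = eq this says
   that {x | P x} is finite of cardinality c. *)
Definition card_mod {T : eqType} (P : T -> Prop) (R : T -> T -> Prop) (c : nat) : Prop :=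
  exists reps : seq T,
    [/\ size reps = c, uniq reps,
        forall x, x \in reps -> P x,
        forall x y, x \in reps -> y \in reps -> R x y -> x = y &
        forall x, P x -> exists2 y, y \in reps & R x y].

(* ---- the five sets; vertices live in 'I_(n+2) so that [n+1] fits ---- *)

Definition Tset (n k : nat) (t : tree n.+2) : Prop :=
  [/\ is_rtree t, t.1 = iv n.+2 n.+1 & MD_card t k.+1].

(* (2) sequences [T_0..T_k] of minimally rooted trees partitioning [n+1];
       counted up to cyclic rotation (rot_equiv) *)
Definition Aset (n k : nat) (s : seq (tree n.+2)) : Prop :=
  [/\ size s = k.+1, all (@is_rtree _) s, all (@min_rooted _) s &
      seq_partition [seq t.1 | t <- s] (iv n.+2 n.+1)].

Definition Bset (n k : nat) (s : seq (tree n.+2)) : Prop :=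
  [/\ k <= size s, ordered_forest_on (iv n.+2 n) s &
      all (@min_rooted _) (drop (size s - k) s)].

Definition Cset (n k : nat) (Fs : seq (seq (tree n.+2))) : Prop :=
  all (fun F => ordered_forest_on (forest_vset F) F && kgood k F) Fs /\
  seq_partition [seq forest_vset F | F <- Fs] (iv n.+2 n).

Definition Fset (n k : nat) (t : tree n.+2) : Prop :=
  [/\ is_rtree t, t.1 = iv n.+2 n.+1, is_leaf t ord_max &
      forall v : 'I_n.+2, 1 <= v <= k -> ~~ is_leaf t v].

Arguments Tset : clear implicits.
Arguments Aset : clear implicits.
Arguments Bset : clear implicits.
Arguments Cset : clear implicits.
Arguments Fset : clear implicits.

(* Main.v *)
Require Import Defs.
From HB Require Import structures.
From mathcomp Require Import all_boot all_order all_algebra.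
From mathcomp Require Import boolp ring.
Set Implicit Arguments. Unset Strict Implicit. Unset Printing Implicit Defensive.
Import GRing.Theory.

(** All five cardinalities equal n! [x^n] M^k / (1 - T), where T and M are the
    exponential generating functions of rooted trees and of minimally rooted
    trees.  With E = exp T (rooted forests) one has T = x E, E' = T' E and
    M E = E - 1: in a nonempty forest take the smallest root r; cutting the
    children of r smaller than r leaves a minimally rooted tree and an arbitrary
    forest, and every pair of these arises once.  Hence 1 - M = 1 / E and
    M' = 1 / (1 - T).

    - Removing the edges of MD(T) leaves k + 1 minimally rooted trees, whose
      roots carry one of k! decreasing trees; this gives k! M^(k+1) / (k+1)! at
      n + 1, that is, M^k M'.
    - A cycle is rotated so that its first tree contains n + 1: M' M^k again.
    - Ordered forests satisfy F = M^k + T F.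
    - Reading a sequence of k-good forests tree by tree, the only state is the
      number p of minimally rooted trees still owed to the current forest; the
      count on a set of size n with b special vertices is n! [x^n] M^(b+p) / (1-T)
      by induction.
    - Being a leaf or a nonleaf are complementary, so the last set is reduced to
      prescribing j + 1 leaves on n + 1 vertices; detaching one of them multiplies
      the count by n - j, the recurrence satisfied by
      n! [x^n] (1 - M)^j / (1 - T). *)

(** * Formal power series *)

Local Open Scope ring_scope.

Record fps := Fps { cf : nat -> rat }.

HB.instance Definition _ := gen_eqMixin fps.
HB.instance Definition _ := gen_choiceMixin fps.

Lemma fpsP (a b : fps) : (forall n, cf a n = cf b n) -> a = b.
Proof. by case: a b => a [b] /= ab; congr Fps; apply/funext. Qed.

Definition fps_add a b := Fps (fun n => cf a n + cf b n).
Definition fps_opp a := Fps (fun n => - cf a n).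
Definition fps_zero := Fps (fun=> 0).
Definition fps_one := Fps (fun n => (n == 0%N)%:R).
Definition fps_mul a b := Fps (fun n => \sum_(i < n.+1) cf a i * cf b (n - i)).

Lemma fps_addA : associative fps_add.
Proof. by move=> a b c; apply: fpsP => n /=; rewrite addrA. Qed.
Lemma fps_addC : commutative fps_add.
Proof. by move=> a b; apply: fpsP => n /=; rewrite addrC. Qed.
Lemma fps_add0 : left_id fps_zero fps_add.
Proof. by move=> a; apply: fpsP => n /=; rewrite add0r. Qed.
Lemma fps_addN : left_inverse fps_zero fps_opp fps_add.
Proof. by move=> a; apply: fpsP => n /=; rewrite addNr. Qed.
HB.instance Definition _ :=
  GRing.isZmodule.Build fps fps_addA fps_addC fps_add0 fps_addN.

(** The n-th coefficient of a product involves only coefficients up to n, so associativity,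
    commutativity and the Leibniz rule can be borrowed from polynomials. *)
Definition trunc N a : {poly rat} := \poly_(i < N) cf a i.

Lemma cf_mul_trunc N a b n : (n < N)%N ->
  cf (fps_mul a b) n = (trunc N a * trunc N b)`_n.
Proof.
move=> nN; rewrite coefM; apply: eq_bigr => i _; rewrite !coef_poly.
by rewrite (leq_ltn_trans _ nN) ?(leq_ltn_trans _ nN) ?leq_subr // -ltnS.
Qed.

Lemma eq_coefM (p p' q : {poly rat}) n : (forall i, (i <= n)%N -> p`_i = p'`_i) ->
  (p * q)`_n = (p' * q)`_n.
Proof. by move=> pp'; rewrite !coefM; apply: eq_bigr => i _; rewrite pp' // -ltnS. Qed.

Lemma fps_mulC : commutative fps_mul.
Proof.
by move=> a b; apply: fpsP => n; rewrite !(cf_mul_trunc _ _ (ltnSn n)) mulrC.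
Qed.

(** The product of two truncations may exceed the truncation of the product, but both agree in
    degrees up to n, and only these enter the n-th coefficient. *)
Lemma trunc_mul a b c n :
  cf (fps_mul (fps_mul a b) c) n = (trunc n.+1 a * trunc n.+1 b * trunc n.+1 c)`_n.
Proof.
rewrite (cf_mul_trunc _ _ (ltnSn n)); apply: eq_coefM => i lin.
by rewrite coef_poly ltnS lin (@cf_mul_trunc n.+1).
Qed.

Lemma fps_mulA : associative fps_mul.
Proof.
move=> a b c; apply: fpsP => n; rewrite fps_mulC !trunc_mul.
by rewrite mulrC mulrA.
Qed.

Lemma fps_mul1 : left_id fps_one fps_mul.
Proof.
move=> a; apply: fpsP => n /=; rewrite big_ord_recl /= mul1r subn0 big1 ?addr0 //.
by move=> i _; rewrite mul0r.
Qed.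

Lemma fps_mulD : left_distributive fps_mul fps_add.
Proof.
move=> a b c; apply: fpsP => n /=; rewrite -big_split /=.
by apply: eq_bigr => i _; rewrite mulrDl.
Qed.

Lemma fps_1neq0 : fps_one != fps_zero.
Proof. by apply/eqP => /(congr1 (cf ^~ 0%N)). Qed.
HB.instance Definition _ :=
  GRing.Zmodule_isComNzRing.Build fps fps_mulA fps_mulC fps_mul1 fps_mulD fps_1neq0.

Lemma cfD a b n : cf (a + b) n = cf a n + cf b n. Proof. by []. Qed.
Lemma cfN a n : cf (- a) n = - cf a n. Proof. by []. Qed.
Lemma cf1 n : cf 1 n = (n == 0%N)%:R. Proof. by []. Qed.
Lemma cfM a b n : cf (a * b) n = \sum_(i < n.+1) cf a i * cf b (n - i).
Proof. by []. Qed.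
Lemma cfMn a m n : cf (a *+ m) n = cf a n *+ m.
Proof. by elim: m => [|m IH]; rewrite ?mulr0n // !mulrS cfD IH. Qed.

Definition fX := Fps (fun n => (n == 1%N)%:R).
Lemma cfX0 a : cf (fX * a) 0 = 0.
Proof. by rewrite cfM big_ord1 mul0r. Qed.
Lemma cfXS a n : cf (fX * a) n.+1 = cf a n.
Proof.
rewrite cfM big_ord_recl mul0r add0r big_ord_recl /= mul1r subSS subn0.
by rewrite big1 ?addr0 // => i _; rewrite mul0r.
Qed.

Definition fder a := Fps (fun n => cf a n.+1 *+ n.+1).
Lemma cf_der a n : cf (fder a) n = cf a n.+1 *+ n.+1. Proof. by []. Qed.
Lemma fderD a b : fder (a + b) = fder a + fder b.
Proof. by apply: fpsP => n; rewrite cf_der !cfD mulrnDl. Qed.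
Lemma fderN a : fder (- a) = - fder a.
Proof. by apply: fpsP => n; rewrite cf_der !cfN mulNrn. Qed.
Lemma fder1 : fder 1 = 0.
Proof. by apply: fpsP => n; rewrite cf_der cf1 mul0rn. Qed.
Lemma fderX : fder fX = 1.
Proof. by apply: fpsP => -[|n]; rewrite cf_der cf1 //= mul0rn. Qed.

Lemma fderM a b : fder (a * b) = fder a * b + a * fder b.
Proof.
have tr m c n : (n < m)%N -> (trunc m c)`_n = cf c n by move=> nm; rewrite coef_poly nm.
apply: fpsP => n; rewrite cf_der cfD.
(* Truncation is at degree n + 2, because the n-th coefficient of a derivative reads the coefficient
   n + 1. *)
rewrite (cf_mul_trunc a b (ltnSn n.+1)) -coef_deriv derivM coefD; congr (_ + _).
  rewrite coefM cfM; apply: eq_bigr => i _; rewrite coef_deriv cf_der !tr //.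
    by rewrite ltnS (leq_trans (leq_subr _ _)).
  by rewrite ltnS ltn_ord.
rewrite coefM cfM; apply: eq_bigr => i _; rewrite coef_deriv cf_der !tr //.
  by rewrite 2!ltnS leq_subr.
by rewrite (leq_trans (ltn_ord i)).
Qed.

Lemma fderXn a k : fder (a ^+ k.+1) = (a ^+ k * fder a) *+ k.+1.
Proof.
elim: k => [|k IH]; first by rewrite expr0 mul1r.
by rewrite exprS fderM IH [RHS]mulrS mulrC mulrnAr mulrA -exprS.
Qed.

(* The coefficient of x^n / n!. *)
Definition ct a n := cf a n * (n`!)%:R.
Definition egf (g : nat -> nat) := Fps (fun n => (g n)%:R / (n`!)%:R).

Lemma fact_rat_neq0 n : (n`!)%:R != 0 :> rat.
Proof. by rewrite Num.Theory.pnatr_eq0 -lt0n fact_gt0. Qed.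

Lemma ct_egf g n : ct (egf g) n = (g n)%:R.
Proof. by rewrite /ct divfK // fact_rat_neq0. Qed.

Lemma ct_inj a b : (forall n, ct a n = ct b n) -> a = b.
Proof. by move=> ab; apply: fpsP => n; apply: (mulIf (fact_rat_neq0 n)); apply: ab. Qed.

Lemma ctD a b n : ct (a + b) n = ct a n + ct b n.
Proof. by rewrite /ct cfD mulrDl. Qed.
Lemma ctN a n : ct (- a) n = - ct a n.
Proof. by rewrite /ct cfN mulNr. Qed.
Lemma ctB a b n : ct (a - b) n = ct a n - ct b n.
Proof. by rewrite ctD ctN. Qed.
Lemma ctMn a m n : ct (a *+ m) n = ct a n *+ m.
Proof. by rewrite /ct cfMn mulrnAl. Qed.
Lemma ct1 n : ct 1 n = (n == 0%N)%:R.
Proof. by rewrite /ct cf1; case: n => [|n]; rewrite ?mul0r // mulr1. Qed.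

Lemma ctM a b n :
  ct (a * b) n = \sum_(i < n.+1) 'C(n, i)%:R * (ct a i * ct b (n - i)).
Proof.
rewrite /ct cfM mulr_suml; apply: eq_bigr => i _.
rewrite -(@bin_fact n i); first by rewrite !natrM; ring.
by rewrite -ltnS.
Qed.

Lemma ct_der a n : ct (fder a) n = ct a n.+1.
Proof. by rewrite /ct cf_der factS natrM -[cf a n.+1 *+ _]mulr_natl; ring. Qed.

Lemma ctX0 a : ct (fX * a) 0 = 0.
Proof. by rewrite /ct cfX0 mul0r. Qed.
Lemma ctXS a n : ct (fX * a) n.+1 = ct a n *+ n.+1.
Proof. by rewrite /ct cfXS factS natrM mulrCA mulr_natl. Qed.

(** * Identities satisfied by the series of rooted and of minimally rooted trees *)

Section RootedTreeSeries.
Variables E T M : fps.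
Hypotheses (TE : T = fX * E) (derE : fder E = fder T * E) (ME : M * E = E - 1).
Let D := 1 - M.
Let L := fder T * D.

Let ED : E * D = 1.
Proof. by rewrite mulrBr mulr1 [E * M]mulrC ME; ring. Qed.

(** Differentiating T = x E gives T' = E + x T' E = E + T T', so T' (1 - T) = E; multiplying by D =
    1 / E yields the claim. *)
Lemma ser_L_inv : L * (1 - T) = 1.
Proof.
have e : fder T * (1 - T) = E.
  by rewrite mulrBr mulr1 {1 3}TE fderM fderX derE TE; ring.
by rewrite /L mulrAC e ED.
Qed.

(** Differentiating M E = E - 1 gives M' E = (1 - M) E' = D T' E, and E is invertible with inverse
    D. *)
Lemma ser_derM : fder M = L.
Proof.
have e : fder M * E + M * fder E = fder E.
  by rewrite -fderM ME fderD fderN fder1 subr0.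
have e2 : fder M * E = D * fder E by apply/eqP; rewrite /D mulrBl mul1r eq_sym subr_eq e.
by rewrite -[LHS]mulr1 -ED mulrA e2 derE -[RHS]mulr1 -ED /L; ring.
Qed.

(** Since E D = 1, x T' = (x E) (T' D) = T L, and L - T L = 1. *)
Lemma ser_L_derT : L = 1 + fX * fder T.
Proof.
have e : fX * fder T = T * L.
  have -> : T * L = fX * E * L by rewrite -TE.
  by rewrite -[LHS]mulr1 -ED /L; ring.
by rewrite e -ser_L_inv; ring.
Qed.

(* T D = x turns D^(j+1) L (1 - T) = D^(j+1) into D^(j+1) L - x D^j L = D^(j+1), and
   the derivative of D^(j+1) is - (j+1) D^j L. *)
Lemma ser_DL_rec j n :
  ct (D ^+ j.+1 * L) n.+1 = (n%:R - j%:R) * ct (D ^+ j * L) n.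
Proof.
have eD : D ^+ j.+1 * L - fX * (D ^+ j * L) = D ^+ j.+1.
  have TD : T * D = fX by rewrite TE -mulrA ED mulr1.
  by rewrite -[RHS]mulr1 -ser_L_inv -TD exprS; ring.
have := congr1 (ct ^~ n.+1) eD; rewrite /= ctB ctXS -[ct (D ^+ _) _]ct_der fderXn.
rewrite /D fderD fderN fder1 sub0r ser_derM -/D mulrN mulNrn ctN ctMn => /eqP.
by rewrite subr_eq => /eqP ->; rewrite -[_ *+ j.+1]mulr_natl -[_ *+ n.+1]mulr_natl -!natr1; ring.
Qed.

End RootedTreeSeries.

Local Close Scope ring_scope.

(** * Rooted forests as parent maps *)

Lemma card_surj (A B : finType) (P : {set A}) (Q : {set B}) (phi : A -> B) :
  {in P, forall x, phi x \in Q} -> {in P &, injective phi} ->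
  (forall y, y \in Q -> exists2 x, x \in P & phi x = y) -> #|P| = #|Q|.
Proof.
move=> PQ inj surj; rewrite -(card_in_imset inj); apply: eq_card => y.
apply/imsetP/idP => [[x xP ->]|/surj [x xP <-]]; [exact: PQ | by exists x].
Qed.

Lemma card_bij (A B : finType) (P : {set A}) (Q : {set B}) (phi : A -> B) (psi : B -> A) :
  {in P, forall x, phi x \in Q} -> {in Q, forall y, psi y \in P} ->
  {in P, cancel phi psi} -> {in Q, cancel psi phi} -> #|P| = #|Q|.
Proof.
move=> PQ QP k k'; apply: (@card_surj _ _ _ _ phi) => // [|y yQ].
  exact: (can_in_inj k).
by exists (psi y); rewrite ?k' ?QP.
Qed.

Lemma sum_card_pair (A B : finType) (P : pred A) (R : A -> pred B) :
  \sum_(a | P a) #|[set b | R a b]| = #|[set u : A * B | P u.1 && R u.1 u.2]|.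
Proof.
under eq_bigr => a _ do rewrite -sum1_card.
by rewrite pair_big_dep /= -sum1_card; apply: eq_bigl => -[a b]; rewrite !inE.
Qed.

Arguments is_rtree : simpl never.
Arguments min_rooted : simpl never.

Section Forests.
Variable N : nat.
Implicit Types (x y r : 'I_N) (X V : {set 'I_N}) (f g h : {ffun 'I_N -> 'I_N}).

(* An orbit of a parent map on N points is stationary after N steps. *)
Definition acyc f := [forall x, f (iter N f x) == iter N f x].
(** For an acyclic parent map this is the root of the tree containing x. *)
Definition ftop f x := iter N f x.
Definition ranked f (rk : 'I_N -> nat) := forall x, f x != x -> rk (f x) < rk x.
Definition stable V f := forall x, x \in V -> f x \in V.

Lemma iter_stable V f m x : stable V f -> x \in V -> iter m f x \in V.
Proof. by move=> Vf xV; elim: m => //= m /Vf. Qed.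

Lemma acyc_ranked f : acyc f -> exists rk, ranked f rk.
Proof.
move=> /forallP af.
(* The rank of x is the number of moving steps among the first N steps of its orbit. Passing to
   [f x] drops the first step, which moves, and adds step N, which does not. *)
exists (fun x => \sum_(0 <= i < N) (f (iter i f x) != iter i f x)) => x fx.
case: N x f af fx => [[]//|n] x f af fx.
rewrite big_nat_recr //= [ltnRHS]big_nat_recl //= fx add1n ltnS.
under eq_bigr => i _ do rewrite -iterSr.
have /eqP := af x; rewrite -iterSr => e.
by rewrite /= in e; rewrite !e eqxx addn0.
Qed.

(** As long as the orbit moves, its rank strictly decreases. If step m still moved, the iterates 0
    to m would be m + 1 distinct elements of V. *)
Lemma ranked_iter_fix f rk V x m : ranked f rk -> stable V f -> x \in V -> #|V| <= m ->
  f (iter m f x) = iter m f x.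
Proof.
move=> rkf Vf xV Vm; apply/eqP/negPn/negP => nfix.
have nf i : i <= m -> f (iter i f x) != iter i f x.
  move=> im; apply: contra nfix => /eqP e.
  rewrite -(subnK im) iterD; elim: (m - i) => [|d /eqP IH]; first by rewrite /= e.
  by rewrite /= !IH.
have dec i d : i + d.+1 <= m.+1 -> rk (iter (i + d.+1) f x) < rk (iter i f x).
  elim: d => [|d IH] lid; first by rewrite addn1 in lid *; apply/rkf/nf.
  rewrite addnS in lid *; apply: leq_trans (IH (ltnW lid)).
  by rewrite /= ltnS; apply/ltnW/rkf/nf.
have inj : injective (fun i : 'I_m.+1 => iter i f x).
  have half (i j : 'I_m.+1) : i < j -> iter i f x <> iter j f x.
    move=> ij e; have := @dec i (j - i).-1.
    have -> : i + (j - i).-1.+1 = j by rewrite prednK ?subn_gt0 // subnKC // ltnW.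
    by rewrite e ltnn => /(_ (ltnW (ltn_ord j))).
  move=> i j e; apply/val_inj/eqP; case: ltngtP => // /half; [by case|].
  by move=> /(_ (esym e)).
have : #|[set iter (i : 'I_m.+1) f x | i in 'I_m.+1]| <= #|V|.
  by apply/subset_leq_card/subsetP => y /imsetP [i _ ->]; apply: iter_stable.
by rewrite card_imset // card_ord ltnNge Vm.
Qed.

Lemma ranked_acyc f rk : ranked f rk -> acyc f.
Proof.
move=> rkf; apply/forallP => x; apply/eqP.
apply: (@ranked_iter_fix _ _ setT _ _ rkf) => //; first by move=> ? _; rewrite inE.
  by rewrite inE.
by rewrite -[leqRHS]card_ord max_card.
Qed.

Definition forest X f :=
  [&& [forall x, (x \notin X) ==> (f x == x)], [forall x in X, f x \in X] & acyc f].
Definition roots X f := [set x in X | f x == x].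

Lemma forestP X f : reflect
  [/\ forall x, x \notin X -> f x = x, stable X f & exists rk, ranked f rk] (forest X f).
Proof.
apply: (iffP and3P) => [[/forallP oX /forall_inP Xf /acyc_ranked rk]|[oX Xf [rk /ranked_acyc af]]].
  by split=> // x xX; apply/eqP/(implyP (oX x)).
split=> //; last exact/forall_inP.
by apply/forallP => x; apply/implyP => /oX ->.
Qed.

Lemma iter_fix f x m : f x = x -> iter m f x = x.
Proof. by move=> e; elim: m => //= m ->. Qed.

Lemma top_fix f x : f x = x -> ftop f x = x. Proof. exact: iter_fix. Qed.

Section Top.
Variables (X : {set 'I_N}) (f : {ffun 'I_N -> 'I_N}).
Hypothesis Xf : forest X f.

Lemma f_top x : f (ftop f x) = ftop f x.
Proof. by case/and3P: Xf => _ _ /forallP /(_ x) /eqP. Qed.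
Lemma top_f x : ftop f (f x) = ftop f x.
Proof. by rewrite /ftop -iterSr /= f_top. Qed.
Lemma forest_stable : stable X f. Proof. by case/forestP: Xf. Qed.
Lemma forest_out x : x \notin X -> f x = x. Proof. by case/forestP: Xf => + _ _; apply. Qed.
Lemma top_stable V x : stable V f -> x \in V -> ftop f x \in V.
Proof. exact: iter_stable. Qed.
Lemma top_roots x : x \in X -> ftop f x \in roots X f.
Proof. by move=> xX; rewrite inE f_top eqxx top_stable //; apply: forest_stable. Qed.
Lemma forest_in x : f x != x -> x \in X.
Proof. by apply: contraNT => /forest_out ->. Qed.
End Top.

(** The definition of a rooted tree iterates [#|V|] times and [acyc] iterates N times; orbits that
    stay in V are stationary after [#|V|] steps, so both see the same root. *)
Lemma is_rtreeP V f :
  reflect (forest V f /\ exists r, roots V f = [set r]) (is_rtree (V, f)).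
Proof.
apply: (iffP idP) => [/andP [/andP [/forallP oV /forall_inP Vf]]|].
  move=> /exists_inP [r rV /andP [/eqP fr /forall_inP top_r]].
  have af : acyc f.
    apply/forallP => x; have [xV|/(implyP (oV x)) /eqP e] := boolP (x \in V).
      have VN : #|V| <= N by rewrite -[leqRHS]card_ord max_card.
      have -> : iter N f x = iter (N - #|V| + #|V|) f x by rewrite subnK.
      by rewrite iterD (eqP (top_r x xV)) iter_fix // fr.
    by rewrite iter_fix // e.
  split; first by rewrite /forest af andbT; apply/andP; split; [apply/forallP | apply/forall_inP].
  exists r; apply/setP => x; rewrite !inE; apply/andP/eqP => [[xV /eqP fx]|->].
    by rewrite -(eqP (top_r x xV)) iter_fix.
  by rewrite fr.
move=> [Vf [r er]]; have [oV sV [rk rkf]] := forestP _ _ Vf.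
have /[!inE] /andP [rV /eqP fr] : r \in roots V f by rewrite er inE.
rewrite /is_rtree; apply/andP; split.
  apply/andP; split; last exact/forall_inP.
  by apply/forallP => x; apply/implyP => /oV ->.
apply/exists_inP; exists r; rewrite // fr eqxx; apply/forall_inP => x xV.
rewrite -in_set1 -er inE (ranked_iter_fix rkf sV xV) // eqxx andbT.
exact: iter_stable.
Qed.

Definition frestr V f : {ffun 'I_N -> 'I_N} := [ffun x => if x \in V then f x else x].
Definition fglue V g h : {ffun 'I_N -> 'I_N} := [ffun x => if x \in V then g x else h x].

Lemma forest_restr X f V : forest X f -> stable V f -> forest V (frestr V f).
Proof.
move=> /forestP [_ _ [rk rkf]] Vf; apply/forestP; split=> [x /negPf xV|x xV|].
- by rewrite ffunE xV.
- by rewrite ffunE xV Vf.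
- by exists rk => x; rewrite ffunE; case: ifP => [_|]; rewrite ?eqxx //; apply: rkf.
Qed.

Lemma roots_restr X f V : V \subset X -> roots V (frestr V f) = roots X f :&: V.
Proof.
move=> /subsetP VX; apply/setP => x; rewrite !inE ffunE.
by case: (boolP (x \in V)) => [/VX ->|_] /=; rewrite ?andbF ?andbT.
Qed.

Lemma forest_glue X V g h : V \subset X -> forest V g -> forest (X :\: V) h ->
  forest X (fglue V g h).
Proof.
move=> /subsetP VX /forestP [oV Vg [rg rkg]] /forestP [oW Wh [rh rkh]].
apply/forestP; split=> [x xX|x xX|].
- rewrite ffunE ifN; first by rewrite oW // inE (negPf xX) andbF.
  by apply: contra xX; apply: VX.
- rewrite ffunE; case: ifPn => [/Vg/VX //|xV].
  by have /Wh /[!inE] /andP [] : x \in X :\: V by rewrite inE xV.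
(* No edge joins V to its complement, so the two ranks never have to be compared. *)
exists (fun x => if x \in V then rg x else rh x) => x; rewrite ffunE.
case: ifPn => [xV|xV] ne; first by rewrite Vg // rkg.
have : h x \notin V; last by move=> /negPf ->; apply: rkh.
have [xX|xX] := boolP (x \in X).
  by have /Wh /[!inE] /andP [] : x \in X :\: V by rewrite inE xV.
by rewrite oW // inE (negPf xX) andbF.
Qed.

Lemma restr_glueL V g h : forest V g -> frestr V (fglue V g h) = g.
Proof.
move=> Vg; apply/ffunP => x; rewrite !ffunE; case: ifPn => xV; rewrite ?xV //.
by rewrite (forest_out Vg).
Qed.

Lemma restr_glueR X V g h : forest (X :\: V) h -> frestr (X :\: V) (fglue V g h) = h.
Proof.
move=> Wh; apply/ffunP => x; rewrite !ffunE !inE.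
case: (boolP (x \in V)) => xV /=; first by rewrite (forest_out Wh) // inE xV.
by case: ifPn => // xX; rewrite (forest_out Wh) // inE (negPf xX) andbF.
Qed.

Lemma glue_restr X V f : forest X f -> fglue V (frestr V f) (frestr (X :\: V) f) = f.
Proof.
move=> Xf; apply/ffunP => x; rewrite !ffunE inE; case: (boolP (x \in V)) => //= xV.
by case: ifPn => // xX; rewrite (forest_out Xf).
Qed.

Definition component X f r := [set x in X | ftop f x == r].

Lemma comp_sub X f r : component X f r \subset X.
Proof. by apply/subsetP => x; rewrite inE => /andP []. Qed.

Section Comp.
Variables (X : {set 'I_N}) (f : {ffun 'I_N -> 'I_N}) (r : 'I_N).
Hypothesis Xf : forest X f.

Lemma stable_comp : stable (component X f r) f.
Proof.
by move=> x; rewrite !inE (top_f Xf) => /andP [/(forest_stable Xf) -> ->].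
Qed.
Lemma stable_compC : stable (X :\: component X f r) f.
Proof.
move=> x; rewrite !inE (top_f Xf) => /andP [+ xX].
by rewrite xX (forest_stable Xf xX) andbT.
Qed.

Hypothesis rX : r \in roots X f.
Lemma rtree_comp : is_rtree (component X f r, frestr (component X f r) f).
Proof.
apply/is_rtreeP; split; first exact: forest_restr Xf stable_comp.
exists r; rewrite (roots_restr _ (comp_sub _ _ _)); apply/setP => x; rewrite !inE.
apply/andP/eqP => [[/andP [xX /eqP fx] /andP [_ /eqP <-]]|->]; first by rewrite top_fix.
by have /[!inE] /andP [-> /eqP e] := rX; rewrite e top_fix // eqxx.
Qed.
End Comp.

(** Both V and its complement in X are stable under the glued map, so an orbit ends at r exactly
    when it starts in V. *)
Lemma comp_glue X V g h r : V \subset X -> forest V g -> roots V g = [set r] ->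
  forest (X :\: V) h -> component X (fglue V g h) r = V.
Proof.
move=> VX Vg rg Wh; have Xf := forest_glue VX Vg Wh.
have /[!inE] /andP [rV _] : r \in roots V g by rewrite rg inE.
have sV : stable V (fglue V g h) by move=> x xV; rewrite ffunE xV (forest_stable Vg).
have sW : stable (X :\: V) (fglue V g h).
  move=> x xW; have /[!inE] /andP [/negPf xV xX] := xW.
  by rewrite ffunE xV; have := forest_stable Wh xW; rewrite inE.
apply/setP => x; rewrite !inE; apply/andP/idP => [[xX /eqP tx]|xV].
  apply/negPn/negP => xV; have : ftop (fglue V g h) x \in X :\: V.
    by apply: iter_stable => //; rewrite inE xV.
  by rewrite tx inE rV.
split; first exact: (subsetP VX).
rewrite -in_set1 -rg inE (iter_stable _ sV xV).
by have := f_top Xf x; rewrite {1}/fglue ffunE (iter_stable _ sV xV) => ->; rewrite eqxx.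
Qed.

(** A tree together with a forest on the remaining vertices is the same as a forest with a marked
    root: the tree is the component of that root. This bijection underlies all product formulas for
    forests. *)
Lemma card_glue X (P Q : pred (tree N)) :
  \sum_(t : tree N | [&& is_rtree t, P t & t.1 \subset X])
     #|[set h | forest (X :\: t.1) h && Q (X :\: t.1, h)]|
  = #|[set u : {ffun 'I_N -> 'I_N} * 'I_N |
       let V := component X u.1 u.2 in
       [&& forest X u.1, u.2 \in roots X u.1, P (V, frestr V u.1)
         & Q (X :\: V, frestr (X :\: V) u.1)]]|.
Proof.
rewrite sum_card_pair; symmetry.
apply: (@card_surj _ _ _ _ (fun u => let V := component X u.1 u.2 in
   ((V, frestr V u.1), frestr (X :\: V) u.1))).
- move=> [f r]; rewrite in_set /= => /and4P [Xf rX Pf Qf].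
  rewrite in_set /= (rtree_comp Xf rX) comp_sub Pf Qf !andbT /=.
  exact: forest_restr Xf (stable_compC Xf).
- move=> [f r] [f' r']; rewrite in_set /= => /and4P [Xf rX _ _].
  rewrite in_set /= => /and4P [Xf' rX' _ _].
  move=> [eV eg eh]; congr (_, _).
    by rewrite -(glue_restr (component X f r) Xf) eg eh {1}eV glue_restr.
  (* The marked root is recovered as the only root of its component. *)
  have [_ [s es]] := is_rtreeP _ _ (rtree_comp Xf rX).
  have [_ [s' es']] := is_rtreeP _ _ (rtree_comp Xf' rX').
  have in_own f1 r1 : r1 \in roots X f1 -> r1 \in roots (component X f1 r1) (frestr (component X f1 r1) f1).
    rewrite (roots_restr _ (comp_sub _ _ _)) !inE => /andP [-> /eqP e].
    by rewrite e top_fix ?eqxx.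
  have := in_own _ _ rX'; rewrite -eg -eV es inE => /eqP ->.
  by have := in_own _ _ rX; rewrite es inE => /eqP ->.
move=> [[V g] h] /[!inE] /= /andP [/and3P [tV Pg VX] /andP [Wh Qh]].
have [Vg [r rg]] := is_rtreeP _ _ tV.
exists (fglue V g h, r); rewrite /= ?inE (comp_glue VX Vg rg Wh) restr_glueL // restr_glueR //.
rewrite forest_glue // Pg Qh !andbT /=.
have /[!inE] /andP [rV /eqP gr] : r \in roots V g by rewrite rg inE.
by rewrite (subsetP VX) // ffunE rV gr eqxx.
Qed.

End Forests.

(** * Counting forests and trees *)

Section SubsetSums.
Local Open Scope ring_scope.
Variables (I : finType) (R : nmodType).
Implicit Types (X V : {set I}) (F : nat -> nat -> R).

(** Binomial convolution: for F a product, this is the product of exponential generating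
    functions. *)
Lemma sum_subsets F X :
  \sum_(V : {set I} | V \subset X) F #|V| #|X :\: V|
  = \sum_(i < #|X|.+1) F i (#|X| - i)%N *+ 'C(#|X|, i).
Proof.
have cV V : V \subset X -> (#|V| < #|X|.+1)%N by rewrite ltnS; apply: subset_leq_card.
rewrite (partition_big (fun V => inord #|V| : 'I_#|X|.+1) predT) //=.
apply: eq_bigr => i _; rewrite -(cards_draws X i) -sumr_const.
apply: eq_big => [V|V /andP [VX /eqP <-]].
  rewrite !inE; case: (boolP (V \subset X)) => //= VX.
  by rewrite -val_eqE /= inordK // cV.
by rewrite inordK ?cV // cardsDS.
Qed.

(** Removing x0 from V shifts the first index by one, so this is the product in which the first
    series is differentiated. *)
Lemma sum_subsets_in F X x0 : x0 \in X ->
  \sum_(V : {set I} | (x0 \in V) && (V \subset X)) F #|V| #|X :\: V|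
  = \sum_(i < #|X|) F i.+1 (#|X|.-1 - i)%N *+ 'C(#|X|.-1, i).
Proof.
move=> x0X; have cX : #|X :\ x0| = #|X|.-1 by rewrite (cardsD1 x0 X) x0X.
have cX' : #|X|.-1.+1 = #|X| by rewrite prednK // (cardsD1 x0 X) x0X.
rewrite (reindex_onto (fun V => x0 |: V) (fun V => V :\ x0)) /=; last first.
  by move=> V /andP [x0V _]; rewrite setD1K.
transitivity (\sum_(V : {set I} | V \subset X :\ x0) F #|V|.+1 #|(X :\ x0) :\: V|).
  apply: eq_big => [V|V /andP [/andP [_ VX] /eqP e]]; last first.
    have x0V : x0 \notin V by rewrite -e !inE eqxx.
    rewrite cardsU1 x0V add1n; congr (F _ #|pred_of_set _|).
    by apply/setP => x; rewrite !inE negb_or andbCA andbA.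
  rewrite setU11 subUset sub1set x0X /= subsetD1; congr (_ && _).
  by apply/eqP/idP => [<-|x0V]; [rewrite !inE eqxx | rewrite setU1K].
by rewrite (sum_subsets (fun n => F n.+1)) cX cX'.
Qed.

End SubsetSums.

Section Counts.
Variable N : nat.
Implicit Types (x y r : 'I_N) (X V : {set 'I_N}) (f g h : {ffun 'I_N -> 'I_N}) (t : tree N).

Definition nforest X := #|[set f | forest X f]|.
Definition ntree (P : pred (tree N)) X := #|[set t | [&& is_rtree t, P t & t.1 == X]]|.

Lemma sum_tree (R : nmodType) (P : pred (tree N)) (C : pred {set 'I_N}) (w : {set 'I_N} -> R) :
  (\sum_(t : tree N | [&& is_rtree t, P t & C t.1]) w t.1
  = \sum_(V : {set 'I_N} | C V) w V *+ ntree P V)%R.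
Proof.
rewrite (partition_big (fun t => t.1) C) => [|t /and3P []//].
apply: eq_bigr => V CV; rewrite /ntree -GRing.sumr_const.
apply: eq_big => [t|t /andP [_ /eqP ->]] //; rewrite inE /=.
by case: eqP => [->|]; rewrite ?CV ?andbT ?andbF.
Qed.

Lemma nforest_set0 : nforest set0 = 1.
Proof.
rewrite -(cards1 [ffun x : 'I_N => x]); apply: eq_card => f; rewrite !inE.
apply/idP/eqP => [/forestP [o _ _]|->]; first by apply/ffunP => x; rewrite ffunE o ?inE.
apply/forestP; split=> [x _|x|]; rewrite ?inE ?ffunE //.
by exists (fun=> 0) => x; rewrite ffunE eqxx.
Qed.

Lemma sum_tree_nforest (P : pred (tree N)) X :
  \sum_(t : tree N | [&& is_rtree t, P t & t.1 \subset X]) nforest (X :\: t.1)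
  = #|[set u : {ffun 'I_N -> 'I_N} * 'I_N | [&& forest X u.1, u.2 \in roots X u.1
       & P (component X u.1 u.2, frestr (component X u.1 u.2) u.1)]]|.
Proof.
transitivity (\sum_(t : tree N | [&& is_rtree t, P t & t.1 \subset X])
    #|[set h | forest (X :\: t.1) h && predT (X :\: t.1, h)]|).
  by apply: eq_bigr => t _; apply: eq_card => h; rewrite !in_set andbT.
by rewrite card_glue; apply: eq_card => u; rewrite !in_set /= andbT.
Qed.

(* E = T-component of x0 times the rest, that is E' = T' E. *)
Lemma sum_tree_nforest_in X x0 : x0 \in X ->
  \sum_(t : tree N | [&& is_rtree t, x0 \in t.1 & t.1 \subset X]) nforest (X :\: t.1)
  = nforest X.
Proof.
move=> x0X; rewrite (sum_tree_nforest (fun t => x0 \in t.1)) /nforest.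
symmetry; apply: (@card_surj _ _ _ _ (fun f => (f, ftop f x0))).
- move=> f; rewrite in_set => Xf; rewrite in_set /= Xf (top_roots Xf) //= inE x0X eqxx.
  by [].
- by move=> f f' _ _ [].
move=> [f r]; rewrite in_set /= => /and3P [Xf rX].
rewrite inE => /andP [_ /eqP e]; exists f; rewrite ?in_set // e; by [].
Qed.

(** This is T = x E: deleting the root r leaves a forest on the other vertices whose roots are the
    children of r. *)
Lemma ntree_root X : ntree predT X = \sum_(r in X) nforest (X :\ r).
Proof.
transitivity (\sum_(f | is_rtree (X, f)) #|roots X f|).
  rewrite (eq_bigr (fun=> 1)); last by move=> f /is_rtreeP [_ [r ->]]; rewrite cards1.
  rewrite sum1_card; symmetry; rewrite -[LHS]cardsE.
  apply: (@card_bij _ _ _ _ (fun f => (X, f)) (fun t => t.2)).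
  - by move=> f; rewrite !inE /= eqxx andbT.
  - by move=> [V f]; rewrite !inE => /and3P [+ _ /eqP <-].
  - by [].
  - by move=> [V f]; rewrite !inE => /and3P [_ _ /eqP <-].
under eq_bigr => f _ do rewrite -sum1_card.
rewrite (exchange_big_dep (fun r => r \in X)) /=; last by move=> f r _ /[!inE] /andP [].
apply: eq_bigr => r rX; rewrite sum1_card -[LHS]cardsE.
(* [phi] cuts all edges into r; [psi] attaches every root of the forest to r. *)
pose phi f : {ffun 'I_N -> 'I_N} := [ffun x => if f x == r then x else f x].
pose psi h : {ffun 'I_N -> 'I_N} :=
  [ffun x => if (x == r) || (x \in X) && (h x == x) then r else h x].
apply: (@card_bij _ _ _ _ phi psi).
- move=> f; rewrite 2!in_set /= => /andP [/is_rtreeP [Xf [s es]] rf].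
  have es' : s = r by apply/eqP; rewrite eq_sym -in_set1 -es.
  subst s; have [oX sX [rk rkf]] := forestP _ _ Xf.
  have fr : f r = r by move: rf; rewrite inE => /andP [_ /eqP].
  apply/forestP; split=> [x|x|].
  + rewrite !inE negb_and negbK ffunE => /orP [/eqP->|/oX ->]; first by rewrite fr eqxx.
    by rewrite if_same.
  + rewrite !inE ffunE => /andP [xr xX]; case: ifPn => [_|->]; first by rewrite xr.
    exact: sX.
  + by exists rk => x; rewrite ffunE; case: ifPn => [|_ /rkf//]; rewrite eqxx.
- move=> h; rewrite in_set => Wh; rewrite in_set; have [oW sW [rk rkh]] := forestP _ _ Wh.
  have hX x : x \in X -> x != r -> h x \in X /\ h x != r.
    by move=> xX xr; have : x \in X :\ r by [rewrite !inE xr]; case/sW/setD1P.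
  have hr : h r = r by apply: oW; rewrite !inE eqxx.
  have Xf : forest X (psi h).
    apply/forestP; split=> [x xX|x xX|].
    + rewrite ffunE (negPf xX) /= orbF ifN; first by rewrite oW // !inE (negPf xX) andbF.
      by apply: contraNneq xX => ->.
    + by rewrite ffunE; case: ifPn => // /norP [xr _]; case: (hX x).
    + exists (fun x => if x == r then 0 else (rk x).+1) => x; rewrite ffunE.
      case: (x =P r) => [->|/eqP xr] /=; first by rewrite eqxx.
      case: ifPn => _ ne; first by rewrite eqxx.
      by case: ifP => // _; rewrite ltnS rkh.
  have er : roots X (psi h) = [set r].
    apply/setP => x; rewrite !inE ffunE; case: (x =P r) => [->|/eqP xr] /=.
      by rewrite rX eqxx.
    apply/negbTE/negP => /andP [xX]; rewrite xX /=; case: ifPn => [_|/negPf->//].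
    by rewrite eq_sym (negPf xr).
  by rewrite unfold_in er set11 andbT; apply/is_rtreeP; split=> //; exists r.
- move=> f; rewrite in_set /= => /andP [/is_rtreeP [Xf [s es]] rf].
  have es' : s = r by apply/eqP; rewrite eq_sym -in_set1 -es.
  subst s; have fr : f r = r by move: rf; rewrite inE => /andP [_ /eqP].
  apply/ffunP => x; rewrite !ffunE; case: (x =P r) => [->|/eqP xr] //=.
  case: (boolP (x \in X)) => [xX|xX] /=; last first.
    by rewrite (forest_out Xf) // if_same.
  case: (f x =P r) => [->|/eqP fx]; first by rewrite eqxx.
  case: ifPn => // fxx; have : x \in roots X f by rewrite inE xX.
  by rewrite es inE (negPf xr).
- move=> h; rewrite in_set => Wh; have [oW sW _] := forestP _ _ Wh.
  apply/ffunP => x; rewrite !ffunE; case: (x =P r) => [->|/eqP xr] /=.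
    by rewrite eqxx oW // !inE eqxx.
  case: (boolP (x \in X)) => xX /=; last by rewrite oW ?inE ?(negPf xX) ?andbF // if_same.
  have : x \in X :\ r by rewrite !inE xr.
  move=> /sW /setD1P [hr _]; case: (h x =P x) => [->|_]; first by rewrite eqxx.
  by rewrite (negPf hr).
Qed.

Lemma min_rootedP V f : reflect
  (forall r x, r \in V -> f r = r -> x \in V -> f x = r -> x != r -> r < x)
  (min_rooted (V, f)).
Proof.
apply: (iffP forallP) => [mr r x rV fr xV fx xr|mr r].
  have /implyP := mr r; rewrite /is_root /= rV fr eqxx => /(_ isT) /forallP /(_ x).
  by rewrite /child /= xV fx eqxx xr.
apply/implyP; rewrite /is_root /= => /andP [rV /eqP fr]; apply/forallP => x.
by apply/implyP; rewrite /child /= => /and3P [xV /eqP fx xr]; apply: mr.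
Qed.

(** This is M E + 1 = E. A minimally rooted tree beside a forest is a forest with a marked root r
    whose children all exceed r. Attaching to r every root smaller than r makes r the smallest root;
    cutting the children of the smallest root that are smaller than it goes back. *)
Lemma sum_min_nforest X :
  \sum_(t : tree N | [&& is_rtree t, min_rooted t & t.1 \subset X]) nforest (X :\: t.1)
  + (X == set0) = nforest X.
Proof.
have [->|/set0Pn [x0 x0X]] := eqVneq X set0.
  rewrite nforest_set0 big_pred0 // => t; apply/and3P => -[tr _].
  rewrite subset0 => /eqP t0; move: tr; case: t t0 => V f /= -> /is_rtreeP [_ [r er]].
  by have := set11 r; rewrite -er !inE.
rewrite addn0 sum_tree_nforest /nforest.
pose phi (u : {ffun 'I_N -> 'I_N} * 'I_N) : {ffun 'I_N -> 'I_N} :=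
  [ffun x => if (x \in roots X u.1) && (x < u.2) then u.2 else u.1 x].
pose A f r := [/\ forest X f, r \in X, f r = r & forall x, f x = r -> x != r -> r < x].
have AP f r : A f r <-> (f, r) \in [set u : {ffun 'I_N -> 'I_N} * 'I_N |
       [&& forest X u.1, u.2 \in roots X u.1
         & min_rooted (component X u.1 u.2, frestr (component X u.1 u.2) u.1)]].
  rewrite in_set /=; split=> [[Xf rX fr mr]|/and3P [Xf + /min_rootedP mr]].
    rewrite Xf inE rX fr eqxx /=; apply/min_rootedP => s x.
    rewrite !inE !ffunE !inE => /andP [sX es]; rewrite sX es /= => fs.
    move: es; rewrite top_fix // => /eqP ->{sX fs} /andP [xX ex].
    by rewrite xX ex; apply: mr.
  rewrite inE => /andP [rX /eqP fr]; split=> // x fx xr.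
  have rV : r \in component X f r by rewrite inE rX top_fix // eqxx.
  have xX : x \in X by apply: (forest_in Xf); rewrite fx eq_sym.
  have xV : x \in component X f r by rewrite inE xX -(top_f Xf) fx top_fix // eqxx.
  by apply: mr; rewrite // ffunE ?rV ?xV.
have phiP f r : A f r -> [/\ forest X (phi (f, r)), phi (f, r) r = r,
    (forall x, x \in X -> phi (f, r) x = x -> r <= x)
   & f = [ffun x => if (phi (f, r) x == r) && (x < r) then x else phi (f, r) x]].
  move=> [Xf rX fr mr]; have [oX sX [rk rkf]] := forestP _ _ Xf; split.
  - apply/forestP; split=> [x xX|x xX|].
    + by rewrite ffunE inE (negPf xX) /= oX.
    + by rewrite ffunE /=; case: ifP => // _; apply: sX.
    (* The new edges all end at r, which stays a root and can therefore take rank 0. *)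
    + exists (fun x => if x == r then 0 else (rk x).+1) => x; rewrite ffunE /= inE.
      case: ifPn => [/andP [/andP [xX fx] xr] _|_ ne].
        by rewrite eqxx; case: eqP xr => // ->; rewrite ltnn.
      case: (x =P r) ne => [->|_]; first by rewrite fr eqxx.
      by case: ifP => // _ /rkf.
  - by rewrite ffunE /= ltnn andbF.
  - move=> x xX; rewrite ffunE /= inE xX /=; case: ifPn => [_ -> //|].
    by rewrite negb_and -leqNgt => /orP [/eqP//|].
  apply/ffunP => x; rewrite !ffunE /= inE; 
  case: (boolP ((x \in X) && (f x == x) && (x < r))) => /=.
    by move=> /andP [/andP [_ /eqP fx] ->]; rewrite eqxx.
  case: (f x =P r) => //= fx _; case: ifP => // xr.
  by have := mr x fx; rewrite neq_ltn xr => /(_ isT); rewrite ltnNge ltnW.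
apply: (@card_surj _ _ _ _ phi).
- by move=> [f r] /AP /phiP [Xf _ _ _]; rewrite in_set.
- move=> [f r] [f' r'] /AP Afr /AP Afr' e.
  have [_ pr lr ef] := phiP _ _ Afr; have [_ pr' lr' ef'] := phiP _ _ Afr'.
  have [_ rX _ _] := Afr; have [_ rX' _ _] := Afr'.
  (* The marked root is the smallest root of the image. *)
  have er : r = r'.
    apply/val_inj/eqP; rewrite eqn_leq; apply/andP; split; first by apply: lr; rewrite ?e.
    by apply: lr'; rewrite -?e.
  by subst r'; rewrite ef ef' e.
move=> f; rewrite in_set => Xf; have [oX sX [rk rkf]] := forestP _ _ Xf.
(* For surjectivity, mark the smallest root and cut its smaller children. *)
case: (arg_minnP (P := mem (roots X f)) val (top_roots Xf x0X)) => r rr lr.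
have /[!inE] /andP [rX /eqP fr] : r \in roots X f by [].
pose f' : {ffun 'I_N -> 'I_N} := [ffun x => if (f x == r) && (x < r) then x else f x].
have Ar : A f' r.
  split=> //.
  - apply/forestP; split=> [x xX|x xX|].
    + by rewrite ffunE oX // if_same.
    + by rewrite ffunE; case: ifP => // _; apply: sX.
    + by exists rk => x; rewrite ffunE; case: ifP => [_|_ /rkf//]; rewrite eqxx.
  - by rewrite ffunE ltnn andbF.
  - move=> x; rewrite ffunE; case: ifPn => [_ ->|+ fx]; first by rewrite eqxx.
    by rewrite fx eqxx /= -leqNgt leq_eqVlt eq_sym val_eqE => /predU1P [->|//]; rewrite eqxx.
exists (f', r); first exact/AP.
apply/ffunP => x; rewrite !ffunE !inE /= ffunE.
case: (boolP ((f x == r) && _)) => [/andP [/eqP fx xr]|ne].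
  rewrite eqxx xr !andbT fx ifT //; apply: (forest_in Xf).
  by rewrite fx neq_ltn xr orbT.
case: ifP => // /andP [/andP [xX /eqP fx] xr].
have : x \in roots X f by rewrite inE xX fx eqxx.
by move=> /lr; rewrite leqNgt xr.
Qed.

(** On a forest [min_rooted] compares every root with its own children, and no edge joins V to its
    complement. *)
Lemma min_rooted_split X V f : V \subset X -> stable V f -> stable (X :\: V) f ->
  min_rooted (X, f) = min_rooted (V, frestr V f) && min_rooted (X :\: V, frestr (X :\: V) f).
Proof.
move=> /subsetP VX sV sW; apply/idP/andP => [/min_rootedP mr|[/min_rootedP mV /min_rootedP mW]].
  split; apply/min_rootedP => r x rV + xV; rewrite !ffunE rV xV => fr fx; apply: mr => //.
  - exact: VX.
  - exact: VX.
  - by have /setDP [] := rV.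
  - by have /setDP [] := xV.
apply/min_rootedP => r x rX fr xX fx xr.
have xrV : (x \in V) = (r \in V).
  apply/idP/idP => [/sV|rV]; first by rewrite fx.
  apply/negPn/negP => xV; have : x \in X :\: V by rewrite inE xV.
  by move=> /sW; rewrite fx inE rV.
have [rV|rV] := boolP (r \in V).
  by apply: mV; rewrite ?xrV // ffunE ?xrV rV.
by apply: mW; rewrite ?ffunE ?inE ?xrV ?rV ?rX ?xX.
Qed.

Definition nminf j X := #|[set f | [&& forest X f, #|roots X f| == j & min_rooted (X, f)]]|.

(** Double counting of forests of j + 1 minimally rooted trees with one marked root: either choose
    the root, or split off its tree. *)
Lemma sum_min_nminf j X :
  \sum_(t : tree N | [&& is_rtree t, min_rooted t & t.1 \subset X]) nminf j (X :\: t.1)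
  = j.+1 * nminf j.+1 X.
Proof.
pose Q (t : tree N) := (#|roots t.1 t.2| == j) && min_rooted t.
have := card_glue X (@min_rooted N) Q => /= ->.
rewrite mulnC /nminf -sum_nat_const.
transitivity (\sum_(f | [&& forest X f, #|roots X f| == j.+1 & min_rooted (X, f)])
   #|[set r | r \in roots X f]|).
  rewrite sum_card_pair; apply: eq_card => -[f r]; rewrite in_set [RHS]in_set /=.
  case: (boolP (forest X f)) => //= Xf.
  case: (boolP (r \in roots X f)) => [rX|_] /=; last by rewrite andbF.
  rewrite (min_rooted_split (comp_sub X f r) (stable_comp Xf) (stable_compC Xf)).
  rewrite /Q /= (roots_restr _ (subsetDl _ _)).
  suff -> : roots X f :&: (X :\: component X f r) = roots X f :\ r.
    by rewrite (cardsD1 r (roots X f)) rX add1n eqSS; do ?case: (_ == _); do ?case: min_rooted.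
  apply/setP => x; rewrite !inE; case: (boolP (x \in X)); rewrite ?andbF //= => xX.
  by case: (f x =P x) => [fx|]; rewrite ?andbF // top_fix // ?andbT.
by apply: eq_big => [f|f /and3P [_ /eqP <- _]]; rewrite ?inE // cardsE; apply: eq_card.
Qed.

Lemma nminf0 X : nminf 0 X = (X == set0).
Proof.
case: eqP => [->|/eqP/set0Pn [x xX]].
  apply: etrans nforest_set0; apply: eq_card => f; rewrite !inE.
  case: (boolP (forest _ _)) => //= _; apply/andP; split.
    by rewrite cards_eq0; apply/eqP/setP => x; rewrite !inE.
  by apply/min_rootedP => r x; rewrite inE.
apply/eqP; rewrite cards_eq0; apply/eqP/setP => f; rewrite !inE.
apply/negP => /and3P [Xf + _]; rewrite cards_eq0 => /eqP e.
by have := top_roots Xf xX; rewrite e inE.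
Qed.

End Counts.

(** * Generating functions *)

(** Counts on a standard n-element set. [tau] is written in the form dictated by T = x E; it is
    shown below to count rooted trees. *)
Definition eps n := nforest [set: 'I_n].
Definition tau n := n * eps n.-1.
Definition mu n := ntree (@min_rooted n) [set: 'I_n].

(** Sum over the vertex set of the tree containing x0. The function [e] is a parameter, required to
    be right on smaller sets only, so that the recurrence can serve inside the induction that
    identifies it. *)
Lemma nforest_rec N (X : {set 'I_N}) (e : nat -> nat) :
  (forall V : {set 'I_N}, #|V| < #|X| -> nforest V = e #|V|) -> X != set0 ->
  nforest X = \sum_(i < #|X|) (i.+1 * e i * e (#|X|.-1 - i)%N) * 'C(#|X|.-1, i).
Proof.
move=> IH /set0Pn [x0 x0X]; rewrite -(sum_tree_nforest_in x0X).
pose C (V : {set 'I_N}) := (x0 \in V) && (V \subset X).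
rewrite (eq_bigl (fun t : tree N => [&& is_rtree t, predT t & C t.1])) //.
rewrite (@sum_tree _ nat predT C (fun V => nforest (X :\: V))).
transitivity (\sum_(V | C V) #|V| * e #|V|.-1 * e #|X :\: V|); last first.
  apply: etrans (@sum_subsets_in _ nat (fun n m => n * e n.-1 * e m) X x0 x0X) _.
  by apply: eq_bigr => i _; rewrite -mulr_natr natn.
apply: eq_bigr => V /andP [x0V VX]; rewrite ntree_root.
have VX' r : r \in V -> #|V :\ r| < #|X|.
  move=> rV; apply: leq_trans (subset_leq_card VX).
  by rewrite (cardsD1 r V) rV.
have -> : \sum_(r in V) nforest (V :\ r) = #|V| * e #|V|.-1.
  rewrite -sum_nat_const; apply: eq_bigr => r rV.
  by rewrite IH ?VX' // (cardsD1 r V) rV.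
rewrite IH; first by rewrite -mulr_natr natn mulrC.
have := cardsD1 x0 X; rewrite x0X add1n => ->; rewrite ltnS.
by apply/subset_leq_card/setDS; rewrite sub1set.
Qed.

(* The recurrence depends on the cardinality only, so no relabelling is needed. *)
Lemma nforest_eps N (X : {set 'I_N}) : nforest X = eps #|X|.
Proof.
have [n cX] := ubnP #|X|; elim: n N X cX => // n IH N X cX.
have [->|X0] := eqVneq X set0.
  rewrite cards0 nforest_set0 /eps.
  by rewrite (_ : [set: 'I_0] = set0) ?nforest_set0 //; apply/setP => -[].
have cT : #|[set: 'I_#|X|]| = #|X| by rewrite cardsT card_ord.
rewrite (nforest_rec (e := eps) _ X0); last first.
  by move=> V VX; apply: IH; apply: leq_trans VX _.
rewrite /eps (nforest_rec (e := eps)) ?cT // -?cards_eq0 ?cT ?cards_eq0 //.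
by move=> V; rewrite ?cT => VX; apply: IH; apply: leq_trans VX _.
Qed.

Lemma ntree_tau N (X : {set 'I_N}) : ntree predT X = tau #|X|.
Proof.
rewrite ntree_root /tau -sum_nat_const; apply: eq_bigr => r rX.
by rewrite nforest_eps (cardsD1 r X) rX.
Qed.

Lemma eps0 : eps 0 = 1.
by have := nforest_eps (set0 : {set 'I_0}); rewrite nforest_set0 cards0.
Qed.

(** In M E + 1 = E the term of full size is the number of minimally rooted trees on X itself; by
    induction everything else depends on [#|X|] alone. *)
Lemma ntree_min_mu N (X : {set 'I_N}) : ntree (@min_rooted N) X = mu #|X|.
Proof.
have [n cX] := ubnP #|X|; elim: n N X cX => // n IH N X cX.
(* Setting [a] to 0 at full size removes that term from the convolution, where it appears separately
   as [ntree]. *)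
pose a i := if i < #|X| then mu i else 0.
have H N' (Y : {set 'I_N'}) : #|Y| = #|X| ->
    ntree (@min_rooted N') Y + \sum_(i < #|X|.+1) (a i * eps (#|X| - i)) * 'C(#|X|, i)
    + (#|X| == 0) = eps #|X|.
  move=> YX; rewrite -YX cards_eq0 -nforest_eps -[RHS]sum_min_nforest; congr (_ + _).
  rewrite (@sum_tree _ nat _ (fun V => V \subset Y) (fun V => nforest (Y :\: V))).
  transitivity (ntree (@min_rooted N') Y
      + \sum_(V : {set 'I_N'} | V \subset Y) a #|V| * eps #|Y :\: V|).
    congr (_ + _); apply/esym; apply: etrans (@sum_subsets _ nat (fun i j => a i * eps j) Y) _.
    by apply: eq_bigr => i _; rewrite -mulr_natr natn.
  rewrite [RHS](bigD1 Y) //= setDv nforest_set0 -mulr_natr mul1r natn; congr (_ + _).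
  rewrite [LHS](bigD1 Y) //= {1}/a YX ltnn mul0n add0n.
  apply: eq_bigr => V /andP [VY nVY].
  have VYc : #|V| < #|Y| by apply: proper_card; rewrite properEneq nVY.
  rewrite /a -YX VYc -IH; last by apply: leq_trans VYc _; rewrite YX.
  by rewrite -mulr_natr natn mulrC nforest_eps.
have cT : #|[set: 'I_#|X|]| = #|X| by rewrite cardsT card_ord.
by have := H _ X erefl; rewrite -(H _ _ cT) => /addIn /addIn.
Qed.

Section Series.
Local Open Scope ring_scope.

(* E, T, M, exp(-T) and 1 / (1 - T) in the notation of the header. *)
Definition fE := egf eps.
Definition fT := egf tau.
Definition fM := egf mu.
Definition fD := 1 - fM.
Definition fL := fder fT * fD.

Lemma fT_E : fT = fX * fE.
Proof.
apply: ct_inj => -[|n]; first by rewrite ct_egf ctX0 /tau mul0n.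
by rewrite ctXS !ct_egf /tau /= mulnC natrM mulr_natr.
Qed.

Lemma fder_E : fder fE = fder fT * fE.
Proof.
apply: ct_inj => n; rewrite ct_der ct_egf ctM.
rewrite [eps n.+1](@nforest_rec _ _ eps); last first.
- by rewrite -cards_eq0 cardsT card_ord.
- by move=> V _; apply: nforest_eps.
rewrite cardsT card_ord natr_sum; apply: eq_bigr => i _.
by rewrite ct_der !ct_egf /tau /= mulnC !natrM.
Qed.

Lemma fM_E : fM * fE = fE - 1.
Proof.
apply: ct_inj => n; rewrite ctB ct1 ct_egf ctM.
rewrite /eps -sum_min_nforest natrD -cards_eq0 cardsT card_ord addrK.
rewrite (@sum_tree _ nat _ (fun V => V \subset _) (fun V => nforest (_ :\: V))).
have natrMn (a b : nat) : (a *+ b)%:R = b%:R * a%:R :> rat.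
  by rewrite -[a *+ b]mulr_natr natn natrM mulrC.
rewrite natr_sum; under [RHS]eq_bigr => V _.
  rewrite natrMn ntree_min_mu nforest_eps; over.
rewrite (@sum_subsets _ rat (fun i j => (mu i)%:R * (eps j)%:R)) cardsT card_ord.
by apply: eq_bigr => i _; rewrite !ct_egf mulr_natl.
Qed.

Lemma fL_inv : fL * (1 - fT) = 1. Proof. exact: ser_L_inv fT_E fder_E fM_E. Qed.
Lemma fder_M : fder fM = fL. Proof. exact: ser_derM fder_E fM_E. Qed.
Lemma fL_derT : fL = 1 + fX * fder fT. Proof. exact: ser_L_derT fT_E fder_E fM_E. Qed.
Lemma fDL_rec j n : ct (fD ^+ j.+1 * fL) n.+1 = (n%:R - j%:R) * ct (fD ^+ j * fL) n.
Proof. exact: ser_DL_rec fT_E fder_E fM_E _ _. Qed.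

Lemma sum_subsets_ct N (X : {set 'I_N}) a b :
  \sum_(V : {set 'I_N} | V \subset X) ct a #|V| * ct b #|X :\: V| = ct (a * b) #|X|.
Proof.
rewrite (@sum_subsets _ rat (fun i j => ct a i * ct b j)) ctM.
by apply: eq_bigr => i _; rewrite mulr_natl.
Qed.

Lemma sum_subsets_in_ct N (X : {set 'I_N}) x0 a b : x0 \in X ->
  \sum_(V : {set 'I_N} | (x0 \in V) && (V \subset X)) ct a #|V| * ct b #|X :\: V|
  = ct (fder a * b) #|X|.-1.
Proof.
move=> x0X; rewrite (@sum_subsets_in _ rat (fun i j => ct a i * ct b j) X x0 x0X) ctM.
rewrite (cardsD1 x0 X) x0X add1n /=.
by apply: eq_bigr => i _; rewrite ct_der mulr_natl.
Qed.

End Series.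

(** * Lists of trees *)

(** Cardinality as a rational number, so that it can be equated directly with a coefficient of a
    series. Sequences of trees do not form a finite type, hence the use of [card_mod]. *)
Definition cmod (T : eqType) (P : T -> Prop) (q : rat) : Prop :=
  exists2 c, card_mod P eq c & (c%:R = q)%R.

Section Cmod.
Local Open Scope ring_scope.
Variables (T : eqType).
Implicit Types (P Q : T -> Prop) (q : rat).

Lemma cmod_ext P Q q : (forall x, P x <-> Q x) -> cmod P q -> cmod Q q.
Proof.
move=> PQ [c [s [sc us sP inj cov]] cq]; exists c => //; exists s; split=> // [x /sP /PQ //|x].
by move=> /PQ /cov.
Qed.

Lemma cmod0 P : (forall x, ~ P x) -> cmod P 0.
Proof. by move=> nP; exists 0%N => //; exists [::]; split=> // x /nP. Qed.

Lemma cmodU P Q p q : (forall x, P x -> Q x -> False) -> cmod P p -> cmod Q q ->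
  cmod (fun x => P x \/ Q x) (p + q).
Proof.
move=> dis [c [s [sc us sP _ cov]] <-] [d [t [td ut tQ _ cov']] <-].
exists (c + d)%N; last by rewrite natrD.
exists (s ++ t); split=> //.
- by rewrite size_cat sc td.
- rewrite cat_uniq us ut andbT /=; apply/hasPn => x /tQ xQ.
  by apply/negP => /sP /dis; apply.
- by move=> x; rewrite mem_cat => /orP [/sP|/tQ]; [left|right].
move=> x [/cov [y ys e]|/cov' [y ys e]]; exists y => //; rewrite mem_cat ys ?orbT //.
Qed.

Lemma cmod1 P x : (forall y, P y <-> y = x) -> cmod P 1.
Proof.
move=> Px; exists 1%N => //; exists [:: x]; split=> // [y|y /Px ->].
  by rewrite inE => /eqP ->; apply/Px.
by exists x; rewrite ?inE.
Qed.

Lemma cmod_card P q c : cmod P q -> c%:R = q -> card_mod P eq c.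
Proof.
by move=> [d dP <-] /eqP; rewrite Num.Theory.eqr_nat => /eqP ->.
Qed.

End Cmod.

Lemma cmod_image (T U : eqType) (P : T -> Prop) (Q : U -> Prop) (phi : T -> U) q :
  (forall x y, P x -> P y -> phi x = phi y -> x = y) ->
  (forall y, Q y <-> exists2 x, P x & y = phi x) -> cmod P q -> cmod Q q.
Proof.
move=> inj PQ [c [s [sc us sP _ cov]] cq]; exists c => //.
exists (map phi s); split.
- by rewrite size_map.
- by rewrite map_inj_in_uniq // => x y /sP Px /sP Py; apply: inj.
- by move=> y /mapP [x /sP Px ->]; apply/PQ; exists x.
- by [].
by move=> y /PQ [x /cov [x' x's ->] ->]; exists (phi x'); rewrite ?map_f.
Qed.

Lemma cmod_sigma (H T U : eqType) (hs : seq H) (P : H -> U -> Prop) (q : H -> rat)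
    (phi : H -> U -> T) (Q : T -> Prop) : uniq hs ->
  (forall h, h \in hs -> cmod (P h) (q h)) ->
  (forall h h' u u', phi h u = phi h' u' -> h = h' /\ u = u') ->
  (forall x, Q x <-> exists h u, [/\ h \in hs, P h u & x = phi h u]) ->
  cmod Q (\sum_(h <- hs) q h)%R.
Proof.
move=> + + inj; elim: hs Q => [|h hs IH] Q /= => [_ _ Qx|/andP [hhs uhs] Pq Qx].
  by rewrite big_nil; apply: cmod0 => x /Qx [h [u []]].
rewrite big_cons.
pose A x := exists2 u, P h u & x = phi h u.
pose B x := exists h u, [/\ h \in hs, P h u & x = phi h u].
apply: (@cmod_ext _ (fun x => A x \/ B x)) => [x|].
  split=> [[[u Pu ->]|[h' [u [h's Pu ->]]]]|/Qx [h' [u []]]].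
  - by apply/Qx; exists h, u; rewrite mem_head.
  - by apply/Qx; exists h', u; rewrite inE h's orbT.
  rewrite inE => /predU1P [-> Pu ->|h's Pu ->]; first by left; exists u.
  by right; exists h', u.
apply: cmodU => [x [u _ ->] [h' [u' [h's _ /inj [e _]]]]| |].
- by rewrite e h's in hhs.
- apply: (cmod_image (P := P h) (phi := phi h)) => [u u' _ _ /inj []//|//|].
  by apply: Pq; rewrite mem_head.
by apply: IH => // h' h's; apply: Pq; rewrite inE h's orbT.
Qed.

(** * Sequences of trees whose vertex sets partition a set *)

Section Partitions.
Variable N : nat.
Implicit Types (X V : {set 'I_N}) (Vs : seq {set 'I_N}) (t : tree N) (s : seq (tree N)).

Lemma all_disjoint V Vs :
  all (fun W : {set 'I_N} => [disjoint V & W]) Vs = [disjoint V & \bigcup_(W <- Vs) W].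
Proof.
elim: Vs => [|W Vs IH] /=; first by rewrite big_nil -setI_eq0 setI0 eqxx.
by rewrite big_cons IH -!setI_eq0 setIUr setU_eq0.
Qed.

Lemma seq_partition_nil X : seq_partition [::] X = (X == set0).
Proof. by rewrite /seq_partition big_nil eq_sym andbT. Qed.

Lemma seq_partition_cons V Vs X :
  seq_partition (V :: Vs) X = [&& V != set0, V \subset X & seq_partition Vs (X :\: V)].
Proof.
rewrite /seq_partition big_cons /= inE negb_or [set0 == V]eq_sym all_disjoint.
set U := \bigcup_(W <- Vs) W.
have shuffle (a b c d e : bool) : [&& a, b && c & d && e] = (a && b) && [&& d, c & e].
  by case: a b c d e => [] [] [] [] [].
rewrite shuffle; have -> : (V :|: U == X) && [disjoint V & U] = (V \subset X) && (U == X :\: V).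
  rewrite -setI_eq0; apply/andP/andP => [[/eqP <- /eqP dis]|[VX /eqP ->]].
    rewrite subsetUl setDUl setDv set0U; split=> //.
    by rewrite -{1}(setID U V) setIC dis set0U.
  by rewrite setDE setICA setICr setI0 eqxx setUIr setUCr setIT (setUidPr VX) eqxx.
by case: (V \subset X); case: (V != set0); rewrite //= andbF.
Qed.

Lemma seq_partition_cat Ws Vs X :
  seq_partition (Vs ++ Ws) X = [&& seq_partition Vs (\bigcup_(V <- Vs) V),
     \bigcup_(V <- Vs) V \subset X & seq_partition Ws (X :\: \bigcup_(V <- Vs) V)].
Proof.
elim: Vs X => [|V Vs IH] X; first by rewrite big_nil seq_partition_nil eqxx sub0set setD0.
rewrite cat_cons !seq_partition_cons IH big_cons -setDDl subUset.
set U := \bigcup_(W <- Vs) W; rewrite subsetUl setDUl setDv set0U.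
case: (V =P set0) => //= _; case: (boolP (V \subset X)) => VX; rewrite ?andbF //=.
rewrite subsetD setDDl.
case: (boolP [disjoint U & V]) => UV; last first.
  rewrite andbF /= andbF; apply/esym/negP => /andP [/andP [/eqP e _] _].
  by case/negP: UV; rewrite -setI_eq0 {1}(e : U = U :\: V) setDE -setIA [~: V :&: V]setIC setICr setI0.
by rewrite andbT (setDidPl UV).
Qed.

Lemma seq_partition_catC Vs Ws X : seq_partition (Vs ++ Ws) X = seq_partition (Ws ++ Vs) X.
Proof.
rewrite /seq_partition !big_cat !pairwise_cat !mem_cat /= setUC orbC.
congr [&& _, _ & _]; rewrite allrelC [X in _ && X]andbC; congr (_ && _).
by apply: eq_allrel => A B; rewrite disjoint_sym.
Qed.

Lemma seq_partition_rot i Vs X : seq_partition (rot i Vs) X = seq_partition Vs X.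
Proof. by rewrite /rot seq_partition_catC cat_take_drop. Qed.

Lemma seq_partition_nth Vs X i j x :  seq_partition Vs X ->
  i < size Vs -> j < size Vs -> x \in nth set0 Vs i -> x \in nth set0 Vs j -> i = j.
Proof.
move=> /and3P [_ /(pairwiseP set0) dis _].
have half a b : b < size Vs -> a < b -> x \in nth set0 Vs a -> x \in nth set0 Vs b -> False.
  move=> bs ab xa xb; have := dis a b; rewrite !inE (ltn_trans ab bs) bs.
  by move=> /(_ isT isT ab) /disjointFr /(_ xa); rewrite xb.
by move=> il jl xi xj; case: (ltngtP i j) => // [/half|/half] H; case: H.
Qed.

Lemma rtree_neq0 t : is_rtree t -> t.1 != set0.
Proof.
case: t => V f /is_rtreeP [_ [r er]]; apply/set0Pn; exists r.
by have := set11 r; rewrite -er inE => /andP [].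
Qed.

Definition minlist k X s := [&& size s == k, all (@is_rtree N) s, all (@min_rooted N) s
  & seq_partition [seq t.1 | t <- s] X].

Lemma card_setD_lt V X : V != set0 -> V \subset X -> #|X :\: V| < #|X|.
Proof.
move=> V0 VX; rewrite cardsDS // ltn_subrL !lt0n !cards_eq0 V0 /=.
by apply: contraNneq V0 => X0; rewrite X0 subset0 in VX.
Qed.

Local Open Scope ring_scope.

Lemma sum_tree_ct (P : pred (tree N)) (C : pred {set 'I_N}) (g : nat -> nat) (w : {set 'I_N} -> rat) :
  (forall V, ntree P V = g #|V|) ->
  \sum_(t : tree N | [&& is_rtree t, P t & C t.1]) w t.1
  = \sum_(V : {set 'I_N} | C V) ct (egf g) #|V| * w V.
Proof.
move=> Pg; rewrite sum_tree; apply: eq_bigr => V _.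
by rewrite Pg ct_egf mulr_natl.
Qed.

(** The common step of all counts of sequences: split off the first tree. What may follow depends on
    that tree only through its vertex set, so trees can be grouped by vertex set. *)
Lemma cmod_treecons (P : pred (tree N)) (C : pred {set 'I_N}) (U T : eqType)
    (R : {set 'I_N} -> U -> Prop) (phi : tree N -> U -> T) (Q : T -> Prop)
    (w : {set 'I_N} -> rat) (g : nat -> nat) :
  (forall V, ntree P V = g #|V|) ->
  (forall t t' u u', phi t u = phi t' u' -> t = t' /\ u = u') ->
  (forall V, C V -> V != set0 -> cmod (R V) (w V)) ->
  (forall x, Q x <-> exists t u, [/\ [&& is_rtree t, P t & C t.1], R t.1 u & x = phi t u]) ->
  cmod Q (\sum_(V : {set 'I_N} | C V) ct (egf g) #|V| * w V).
Proof.
move=> Pg inj Rw Qx; rewrite -(sum_tree_ct _ _ Pg) -big_filter.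
apply: (cmod_sigma (P := fun t => R t.1) (phi := phi) (q := fun t => w t.1)) => //.
- by rewrite filter_uniq // index_enum_uniq.
- move=> t; rewrite mem_filter => /andP [/and3P [tt _ Ct] _].
  by apply: Rw => //; apply: rtree_neq0.
move=> x; split=> [/Qx [t [u [tP Ru ->]]]|[t [u []]]].
  by exists t, u; rewrite mem_filter tP mem_index_enum.
by rewrite mem_filter => /andP [tP _] Ru ->; apply/Qx; exists t, u.
Qed.

Lemma cmod_minlist k X : cmod (minlist k X) (ct (fM ^+ k) #|X|).
Proof.
elim: k X => [|k IH] X.
  rewrite expr0 ct1 cards_eq0; have [->|X0] := eqVneq X set0.
    apply: (cmod1 (x := [::])) => s; split=> [/and4P [/nilP ->]//|->].
    by rewrite /minlist /= seq_partition_nil eqxx.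
  by apply: cmod0 => s /and4P [/nilP ->] _ _; rewrite seq_partition_nil (negPf X0).
rewrite exprS -sum_subsets_ct.
apply: (cmod_treecons (P := @min_rooted N) (C := fun V => V \subset X)
  (R := fun V => minlist k (X :\: V)) (phi := fun t s => t :: s)) => [V|t t' u u' []//|//|s].
  exact: ntree_min_mu.
split=> [|[t [u [/and3P [tt mt tX] /and4P [su tu mu' pu] ->]]]].
  case: s => [|t s] /and4P [//= sk /andP [tt ts] /andP [mt ms]].
  rewrite seq_partition_cons => /and3P [_ tX pX]; exists t, s; split=> //.
    by rewrite tt mt tX.
  by apply/and4P.
by rewrite /minlist /= eqSS su tt tu mt mu' seq_partition_cons tX pu rtree_neq0.
Qed.

(** Requiring x0 in the first tree differentiates its series, and M' = L. *)
Lemma cmod_minlist_in k X x0 : x0 \in X ->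
  cmod (fun s => minlist k.+1 X s /\ exists t u, s = t :: u /\ x0 \in t.1)
    (ct (fM ^+ k * fL) #|X|.-1).
Proof.
move=> x0X; rewrite mulrC -fder_M -(sum_subsets_in_ct _ _ x0X).
apply: (cmod_treecons (P := @min_rooted N) (C := fun V => (x0 \in V) && (V \subset X))
  (R := fun V => minlist k (X :\: V)) (phi := fun t s => t :: s)) => [V|t t' u u' []//|V _ _|s].
- exact: ntree_min_mu.
- exact: cmod_minlist.
split=> [[ms [t [u [es x0t]]]]|[t [u [/and3P [tt mt /andP [x0t tX]] /and4P [su tu mu' pu] ->]]]].
  move: ms; rewrite es => /and4P [su /andP [tt tu] /andP [mt mu']].
  rewrite seq_partition_cons => /and3P [_ tX pX]; exists t, u; split=> //.
    by rewrite tt mt tX x0t.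
  by apply/and4P.
split; last by exists t, u.
by rewrite /minlist /= eqSS su tt tu mt mu' seq_partition_cons tX pu rtree_neq0.
Qed.

Definition blist k X s := [&& (k <= size s)%N, all (@is_rtree N) s,
  seq_partition [seq t.1 | t <- s] X & all (@min_rooted N) (drop (size s - k) s)].

Lemma cmod_blist k X : cmod (blist k X) (ct (fM ^+ k * fL) #|X|).
Proof.
have [n cX] := ubnP #|X|; elim: n X cX => // n IH X cX.
(* Either there are exactly k trees, or an arbitrary first tree precedes a shorter forest of the
   same kind. *)
have -> : fM ^+ k * fL = fM ^+ k + fT * (fM ^+ k * fL).
  by rewrite -[X in X + _]mulr1 -fL_inv; ring.
rewrite ctD -sum_subsets_ct.
pose Q s := exists t u, [/\ [&& is_rtree t, predT t & t.1 \subset X],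
  blist k (X :\: t.1) u & s = t :: u].
apply: (@cmod_ext _ (fun s => minlist k X s \/ Q s)) => [s|].
  split=> [[/and4P [/eqP <- ts ms ps]|]|].
  - by rewrite /blist leqnn ts ps subnn drop0.
  - move=> [t [u [/and3P [tt _ tX] /and4P [ku tu pu mu'] ->]]].
    by rewrite /blist /= leqW // tt tu subSn // seq_partition_cons tX pu mu' rtree_neq0.
  case: (ltnP k (size s)) => [kls|sk] /and4P [ks ts ps ms]; last first.
    left; have ek : size s = k by apply/eqP; rewrite eqn_leq sk.
    by rewrite /minlist ek eqxx ts ps; move: ms; rewrite ek subnn drop0 => ->.
  case: s kls ts ps ms {ks} => // t u ku /andP [tt tu].
  rewrite seq_partition_cons => /and3P [t0 tX pu]; rewrite /= subSn // => mu'.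
  by right; exists t, u; split; rewrite // ?tt ?tX //; apply/and4P.
apply: cmodU.
- move=> s /and4P [/eqP ss _ _ _] [t [u [_ /and4P [ku _ _ _] es]]].
  by move: ku; rewrite -ss es /= ltnn.
- exact: cmod_minlist.
apply: (cmod_treecons (P := predT) (C := fun V => V \subset X)
  (R := fun V => blist k (X :\: V)) (phi := fun t s => t :: s)) => [V|t t' u u' []//|V VX V0|//].
  exact: ntree_tau.
by apply: IH; apply: leq_trans (card_setD_lt V0 VX) _.
Qed.

End Partitions.

(** * Sequences of good forests *)

Section Lukasiewicz.
Variables (N : nat) (K : {set 'I_N}).
Implicit Types (X V : {set 'I_N}) (t : tree N) (s : seq (tree N)) (Fs : seq (seq (tree N))).

Definition special_single V := [exists v, (V == [set v]) && (v \in K)].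

(* A Lukasiewicz path from height p to its first visit of 0: p counts the minimally
   rooted trees still to be read, each tree read pays one and each special vertex
   asks for one more. *)
Fixpoint luk p s := match s with
  | [::] => p == 0
  | t :: s' => [&& 0 < p, min_rooted t & luk (p.-1 + #|t.1 :&: K|) s']
  end.

(** The first tree is unrestricted and its special vertices fix the initial height; a single tree
    without special vertices is the empty path. A single special vertex is the additional case. *)
Definition good s := match s with
  | [::] => false
  | t :: s' => special_single t.1 && nilp s' || luk #|t.1 :&: K| s'
  end.

(** After i trees the height is p plus the special vertices read minus i; it must be positive before
    each tree and zero at the end. *)
Lemma luk_prefix p s : luk p s = [&& all (@min_rooted N) s,
  all (fun i => i < p + \sum_(t <- take i s) #|t.1 :&: K|) (iota 0 (size s))
  & p + \sum_(t <- s) #|t.1 :&: K| == size s].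
Proof.
elim: s p => [|t s IH] p /=; first by rewrite big_nil addn0.
rewrite IH big_nil addn0 big_cons; case: p => [|p] /=; first by rewrite andbF.
rewrite -[1]addn0 iotaDl all_map.
have -> : all (preim (addn 1) (fun i => i < p.+1 + \sum_(u <- take i (t :: s)) #|u.1 :&: K|))
    (iota 0 (size s))
  = all (fun i => i < p + #|t.1 :&: K| + \sum_(u <- take i s) #|u.1 :&: K|) (iota 0 (size s)).
  by apply: eq_all => i; rewrite !inE /= add1n /= big_cons addSn ltnS addnA.
by rewrite addSn eqSS addnA andbA.
Qed.

(* u.1 is the unread part of the current forest, u.2 the forests after it. *)
Definition cstate X p (u : seq (tree N) * seq (seq (tree N))) :=
  [&& luk p u.1, all good u.2, all (@is_rtree N) (u.1 ++ flatten u.2)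
    & seq_partition [seq t.1 | t <- u.1 ++ flatten u.2] X].

Local Open Scope ring_scope.

Lemma cardI_split V X : V \subset X -> (#|(X :\: V) :&: K| + #|V :&: K| = #|X :&: K|)%N.
Proof.
move=> VX; rewrite -(cardsID V (X :&: K)) addnC; congr (_ + _)%N; apply: eq_card => x.
  by rewrite !inE andbAC; case: (boolP (x \in V)) => [/(subsetP VX) ->|]; rewrite ?andbF.
by rewrite !inE; do !case: (_ \in _).
Qed.

Lemma sum_special_single X (w : nat -> rat) :
  \sum_(V : {set 'I_N} | (V \subset X) && special_single V) w #|V| = w 1%N *+ #|X :&: K|.
Proof.
rewrite -(card_imset (mem (X :&: K)) (@set1_inj _)) -sumr_const.
apply: eq_big => [V|V /andP [_ /existsP [v /andP [/eqP -> _]]]]; last by rewrite cards1.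
apply/andP/imsetP => [[VX /existsP [v /andP [/eqP eV vK]]]|[v /[!inE] /andP [vX vK] ->]].
  by exists v; rewrite // !inE vK andbT -sub1set -eV.
by rewrite sub1set vX; split=> //; apply/existsP; exists v; rewrite eqxx.
Qed.

(** Let b count the special vertices of X. Reading a minimally rooted tree moves its special
    vertices from b to p and lowers p by one, so b + p drops by one and a factor M is split off. At
    p = 0 a new forest starts. *)
Lemma cmod_cstate X p :
  cmod (cstate X p) (ct (fM ^+ (#|X :&: K| + p) * fL) #|X|).
Proof.
have [n cX] := ubnP #|X|; elim: n X p cX => // n IH X p cX.
have IHV V q : V != set0 -> V \subset X ->
    cmod (cstate (X :\: V) (q + #|V :&: K|))
      (ct (fM ^+ (#|X :&: K| + q) * fL) #|X :\: V|).
  move=> V0 VX; rewrite -(cardI_split VX) addnAC -addnA; apply: IH.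
  by apply: leq_trans (card_setD_lt V0 VX) _.
case: p => [|p]; last first.
  rewrite addnS exprS -mulrA -sum_subsets_ct.
  apply: (cmod_treecons (P := @min_rooted N) (C := fun V => V \subset X)
    (R := fun V => cstate (X :\: V) (p + #|V :&: K|))
    (phi := fun t u => (t :: u.1, u.2))) => [V|t t' [u v] [u' v'] [-> -> ->]//|V VX V0|[s Fs]].
  - exact: ntree_min_mu.
  - exact: IHV.
  split=> [|[t [[s' Fs'] [/and3P [tt mt tX] /and4P [/= lu gF tu pu] [-> ->]]]]].
    case: s => [|t s] /and4P [//= /andP [mt ls] gF /andP [tt ts]].
    rewrite seq_partition_cons => /and3P [_ tX pX]; exists t, (s, Fs); split=> //=.
      by rewrite tt mt tX.
    by apply/and4P.
  by rewrite /cstate /= mt lu gF tt tu seq_partition_cons rtree_neq0 // tX pu.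
rewrite addn0; have [X0|X0] := eqVneq X set0.
  rewrite X0 set0I cards0 expr0 mul1r (_ : ct fL 0 = 1); last first.
    by rewrite fL_derT ctD ct1 ctX0 addr0.
  apply: (cmod1 (x := ([::], [::]))) => -[s Fs]; split=> [|[-> ->]]; last first.
    by rewrite /cstate /= seq_partition_nil eqxx.
  case/and4P; case: s => //= _; case: Fs => // -[//|t s] Fs _ /= /andP [tt _].
  by rewrite seq_partition_cons subset0 (negPf (rtree_neq0 tt)).
pose b := #|X :&: K|.
(* At height 0 nothing is left unread, so a state is a list of whole forests; [phi] puts the opening
   tree back in front of its forest. *)
pose phi t (u : seq (tree N) * seq (seq (tree N))) : seq (tree N) * seq (seq (tree N)) :=
  ([::], (t :: u.1) :: u.2).
pose Q1 x := exists t u, [/\ [&& is_rtree t, predT t & (t.1 \subset X) && special_single t.1],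
   cstate (X :\: t.1) 0 u & x = phi t u].
pose Q2 x := exists t u, [/\ [&& is_rtree t, predT t & t.1 \subset X],
   cstate (X :\: t.1) #|t.1 :&: K| u & x = phi t u].
have phi_inj t t' u u' : phi t u = phi t' u' -> t = t' /\ u = u'.
  by case: u u' => [u v] [u' v'] [-> -> ->].
(* The first summand counts forests consisting of one special vertex, with b choices. As (M^b)' = b
   M^(b-1) L, it is the coefficient of M^b at [#|X|], and M^b + T M^b L = M^b L. *)
have -> : ct (fM ^+ b * fL) #|X| =
    ct (fM ^+ b.-1 * fL) #|X|.-1 *+ b + ct (fT * (fM ^+ b * fL)) #|X|.
  have -> : ct (fM ^+ b.-1 * fL) #|X|.-1 *+ b = ct (fM ^+ b) #|X|.
    rewrite -(prednK (n := #|X|)) ?card_gt0 // -ct_der; case: (b) => [|b'].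
      by rewrite mulr0n expr0 fder1 /ct mul0r.
    by rewrite /= fderXn fder_M ctMn.
  by rewrite -ctD -[fM ^+ b in X in X + _]mulr1 -fL_inv; congr ct; ring.
apply: (@cmod_ext _ (fun x => Q1 x \/ Q2 x)) => [[s Fs]|].
  split.
    case=> [] [t [[u v] [/and3P [tt _ +] /and4P [/= lu gv tuv puv] [-> ->]]]].
      move=> /andP [tX sst].
      case: u lu tuv puv => // _ tuv puv.
      by rewrite /cstate /= sst gv tt tuv seq_partition_cons rtree_neq0 // tX puv.
    move=> tX.
    by rewrite /cstate /= lu orbT gv tt tuv seq_partition_cons rtree_neq0 // tX puv.
  case/and4P; case: s => //= _; case: Fs => [|[//|t s] Fs] /=.
    by rewrite seq_partition_nil (negPf X0).
  move=> /andP [gt gF] /andP [tt ts].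
  rewrite seq_partition_cons => /and3P [_ tX pX].
  case/orP: gt => [/andP [sst /nilP s0]|ls].
    left; exists t, (s, Fs); split=> //; first by rewrite tt tX sst.
    by rewrite s0 in ts pX *; apply/and4P.
  by right; exists t, (s, Fs); split; rewrite ?tt ?tX //; apply/and4P.
apply: cmodU.
(* The cases exclude each other: a special vertex alone leaves height 1, not 0. *)
- move=> [s Fs] [t [[u v] [/and3P [_ _ /andP [_ /existsP [x /andP [/eqP et xK]]]]
    /and4P [/= lu _ _ _] [_ ->]]]].
  move=> [t' [[u' v'] [_ /and4P [/= lu' _ _ _] [_ ett eu _]]]].
  move: lu'; rewrite -ett -eu et; case: u lu {eu} => // _ /=.
  by rewrite (setIidPl _) ?cards1 ?sub1set.
- have -> : ct (fM ^+ b.-1 * fL) #|X|.-1 *+ b =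
      \sum_(V : {set 'I_N} | (V \subset X) && special_single V)
         ct (egf tau) #|V| * ct (fM ^+ b.-1 * fL) #|X :\: V|.
    rewrite (eq_bigr (fun V : {set 'I_N} =>
      ct (egf tau) #|V| * ct (fM ^+ b.-1 * fL) (#|X| - #|V|)%N)).
      rewrite (sum_special_single X (fun m => ct (egf tau) m * ct _ (#|X| - m)%N)).
      by rewrite ct_egf /tau /= eps0 muln1 mul1r subn1.
    by move=> V /andP [VX _]; rewrite cardsDS.
  apply: (cmod_treecons (P := predT)
    (C := fun V => (V \subset X) && special_single V)
    (R := fun V => cstate (X :\: V) 0) (phi := phi)) => [V|//|V /andP [VX sV] V0|//].
    exact: ntree_tau.
  have -> : b.-1 = (#|(X :\: V) :&: K| + 0)%N.
    rewrite /b -(cardI_split VX) addn0; case/existsP: sV => v /andP [/eqP -> vK].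
    have /setIidPl -> : [set v] \subset K by rewrite sub1set.
    by rewrite cards1 addn1.
  by apply: IH; apply: leq_trans (card_setD_lt V0 VX) _.
rewrite -sum_subsets_ct.
apply: (cmod_treecons (P := predT) (C := fun V => V \subset X)
  (R := fun V => cstate (X :\: V) #|V :&: K|) (phi := phi)) => [V|//|V VX V0|//].
  exact: ntree_tau.
by have := IHV V 0%N V0 VX; rewrite addn0.
Qed.

Lemma card_bigcup_disjoint (Vs : seq {set 'I_N}) :
  pairwise (fun A B : {set 'I_N} => [disjoint A & B]) Vs ->
  #|(\bigcup_(V <- Vs) V) :&: K| = (\sum_(V <- Vs) #|V :&: K|)%N.
Proof.
elim: Vs => [|V Vs IH] /=; first by rewrite !big_nil set0I cards0.
rewrite all_disjoint => /andP [dis /IH e]; rewrite !big_cons -e setIUl cardsU.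
rewrite [X in (_ - X)%N](_ : _ = 0%N) ?subn0 //; apply/eqP; rewrite cards_eq0.
by rewrite setIACA (disjoint_setI0 dis) set0I.
Qed.

End Lukasiewicz.

(** * Good forests as paths *)

Section KGood.
Variables (N k : nat).
Implicit Types (X V : {set 'I_N}) (t : tree N) (s : seq (tree N)) (Fs : seq (seq (tree N))).

Lemma nspecialE s i : pairwise (fun A B : {set 'I_N} => [disjoint A & B]) [seq t.1 | t <- s] ->
  nspecial k s i = \sum_(t <- take i.+1 s) #|t.1 :&: iv N k|.
Proof.
move=> dis; rewrite /nspecial -(big_map (fun t : tree N => t.1) predT id) /=.
rewrite -(big_map (fun t : tree N => t.1) predT (fun V => #|V :&: iv N k|)) /=.
apply: card_bigcup_disjoint; rewrite map_take.
by apply: subseq_pairwise dis; apply: take_subseq.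
Qed.

(** The count over the trees 0 to i is the initial height given by the first tree plus the first i
    trees after it, which matches the prefix condition of [luk_prefix]. *)
Lemma kgood_good s X : seq_partition [seq t.1 | t <- s] X -> kgood k s = good (iv N k) s.
Proof.
case: s => // t s /and3P [_ dis _]; rewrite /kgood /good /special_single.
case: s dis => [|t' s] dis.
  by rewrite /= andbT cards_eq0 setI_eq0.
rewrite [nilp _]/= andbF orFb [_ == 0]/= luk_prefix; congr [&& _, _ & _].
  apply/forallP/allP => [H i|H i].
    rewrite mem_iota => /andP [_ il].
    by have := H (Ordinal il); rewrite nspecialE //= big_cons.
  by have := H i; rewrite mem_iota ltn_ord => /(_ isT); rewrite nspecialE //= big_cons.
by rewrite nspecialE // take_oversize // big_cons.
Qed.

(** A partition into forests that are themselves partitioned into trees is one partition into all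
    the trees; a good forest is nonempty, hence so is its vertex set. *)
Lemma Cset_flatten Fs X :
  all (fun F => ordered_forest_on (forest_vset F) F && kgood k F) Fs &&
    seq_partition [seq forest_vset F | F <- Fs] X
  = cstate (iv N k) X 0 ([::], Fs).
Proof.
rewrite /cstate /=; elim: Fs X => [|s Fs IH] X //=.
rewrite seq_partition_cons all_cat map_cat seq_partition_cat /ordered_forest_on /forest_vset.
rewrite -(big_map (fun t : tree N => t.1) predT id) /=.
set V := \bigcup_(_ <- _) _.
have [tps|] := boolP (all (@is_rtree N) s && seq_partition [seq t.1 | t <- s] V); last first.
  by rewrite negb_and => /orP [] /negPf ->; rewrite ?andbF ?andFb.
have /andP [ts ps] := tps; rewrite ts ps (kgood_good ps) /=.
have [gs|] := boolP (good _ s) => //=.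
have -> : V != set0.
  case: s @V {IH tps} gs ts ps => // t s V _ /= /andP [tt _] _.
  by rewrite /V big_cons setU_eq0 negb_and rtree_neq0.
have := IH (X :\: V); rewrite /=.
case: (V \subset X); last by rewrite !andbF.
by move=> ->; rewrite /=.
Qed.

End KGood.

(** * Prescribed leaves *)

Section Leaves.
Variable N : nat.
Implicit Types (x y v r : 'I_N) (X V J B : {set 'I_N}) (f g h d : {ffun 'I_N -> 'I_N}).

Lemma is_leafP X f v :
  reflect (forall x, x \in X -> f x = v -> x = v) (is_leaf (X, f) v).
Proof.
apply: (iffP forallP) => [lf x xX fx|lf x].
  by apply/eqP; have := lf x; rewrite /child /= xX fx eqxx /= negbK.
by rewrite /child /=; apply/and3P => -[xX /eqP /(lf x xX) ->]; rewrite eqxx.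
Qed.

(** If the leaf v were the root, no other vertex could reach it: the rest of X would be stable and
    contain a second root. *)
Lemma leaf_not_root X f v : is_rtree (X, f) -> is_leaf (X, f) v -> v \in X -> X :\ v != set0 ->
  f v \in X :\ v.
Proof.
move=> /is_rtreeP [Xf [r er]] /is_leafP lf vX /set0Pn [x xXv].
rewrite !inE (forest_stable Xf vX) andbT; apply/eqP => fv.
have sW : stable (X :\ v) f.
  move=> y /setD1P [yv yX]; rewrite !inE (forest_stable Xf yX) andbT.
  by apply: contraNneq yv => /(lf y yX) ->.
have vr : v = r by apply/eqP; rewrite -in_set1 -er inE vX fv eqxx.
have /setD1P [tv tX] := iter_stable N sW xXv.
have : ftop f x \in roots X f by rewrite inE tX (f_top Xf) eqxx.
by rewrite er inE -vr (negPf tv).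
Qed.

(** Detaching the leaf v: a tree is recovered from the parent of v and the tree on the remaining
    vertices. [Q] carries further conditions through the bijection. *)
Lemma card_leaf X v (Q : pred ('I_N * {ffun 'I_N -> 'I_N})) : v \in X -> X :\ v != set0 ->
  #|[set f | [&& is_rtree (X, f), is_leaf (X, f) v & Q (f v, frestr (X :\ v) f)]]|
  = #|[set u | [&& u.1 \in X :\ v, is_rtree (X :\ v, u.2) & Q u]]|.
Proof.
move=> vX X0.
apply: (@card_bij _ _ _ _ (fun f => (f v, frestr (X :\ v) f))
  (fun u => [ffun x => if x == v then u.1 else u.2 x])).
- move=> f; rewrite in_set => /and3P [tf lf Qf]; rewrite in_set Qf (leaf_not_root tf) //= andbT.
  have := leaf_not_root tf lf vX X0; have [Xf [r er]] := is_rtreeP _ _ tf => fvX.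
  have sW : stable (X :\ v) f.
    move=> y /setD1P [yv yX]; rewrite !inE (forest_stable Xf yX) andbT.
    by apply: contraNneq yv => /(is_leafP _ _ _ lf y yX) ->.
  apply/is_rtreeP; split; first exact: forest_restr Xf sW.
  exists r; rewrite (roots_restr _ (subD1set _ _)) er; apply/setIidPl; rewrite sub1set !inE.
  have /[!inE] /andP [-> /eqP fr] : r \in roots X f by rewrite er inE.
  by rewrite andbT; apply: contraTneq fvX => <-; rewrite fr !inE eqxx.
- move=> [y h]; rewrite [_ \in _]in_set /= => /and3P [yX /is_rtreeP [Wh [r er]] Qh].
  have [oW sW [rk rkh]] := forestP _ _ Wh; have /setD1P [yv yX'] := yX.
  pose f : {ffun 'I_N -> 'I_N} := [ffun x => if x == v then y else h x].
  have hv : h v = v by apply: oW; rewrite !inE eqxx.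
  have /[!inE] /andP [/andP [rv rX] /eqP hr] : r \in roots (X :\ v) h by rewrite er inE.
  have hneq x : x != v -> h x != v.
    move=> xv; have [xX|xX] := boolP (x \in X); last by rewrite oW // !inE (negPf xX) andbF.
    by have /sW /setD1P [] : x \in X :\ v by rewrite !inE xv.
  rewrite ffunE eqxx.
  rewrite (_ : frestr _ _ = h); last first.
    apply/ffunP => x; rewrite !ffunE; case: ifPn => [/setD1P [/negPf -> //]|xW].
    by rewrite oW.
  rewrite Qh andbT; apply/andP; split.
    apply/is_rtreeP; split.
      apply/forestP; split=> [x xX|x xX|].
      + rewrite ffunE ifN; first by rewrite oW // !inE (negPf xX) andbF.
        by apply: contraNneq xX => ->.
      + rewrite ffunE; case: eqP => // /eqP xv.
        by have /sW /setD1P [] : x \in X :\ v by rewrite !inE xv.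
      + exists (fun x => if x == v then (rk y).+1 else rk x) => x; rewrite ffunE.
        case: (x =P v) => [_|/eqP xv] ne; first by rewrite (negPf yv).
        by rewrite (negPf (hneq x xv)) rkh.
    exists r; apply/setP => x; rewrite !inE ffunE; case: (x =P v) => [->|/eqP xv].
      by rewrite (negPf yv) andbF eq_sym (negPf rv).
    by have := congr1 (fun A : {set 'I_N} => x \in A) er; rewrite !inE xv.
  apply/is_leafP => x xX; rewrite ffunE; case: eqP => // /eqP /hneq /eqP. by [].
- move=> f; rewrite in_set => /and3P [tf lf Qf]; apply/ffunP => x; rewrite !ffunE /=.
  case: (x =P v) => [->//|/eqP xv]; case: ifPn => // xW.
  have [Xf _] := is_rtreeP _ _ tf; rewrite (forest_out Xf) //.
  by apply: contra xW => xX; rewrite !inE xv.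
- move=> [y h]; rewrite in_set /= => /and3P [_ /is_rtreeP [Wh _] _].
  rewrite ffunE eqxx; congr (_, _); apply/ffunP => x; rewrite !ffunE.
  case: ifPn => [/setD1P [/negPf -> //]|xW]; by rewrite (forest_out Wh).
Qed.

Lemma card_rtree X : #|[set f | is_rtree (X, f)]| = tau #|X|.
Proof.
rewrite -ntree_tau; apply: (@card_bij _ _ _ _ (fun f => (X, f)) (fun t => t.2)).
- by move=> f; rewrite !inE /= eqxx andbT.
- by move=> [V f]; rewrite !inE => /and3P [+ _ /eqP <-].
- by [].
- by move=> [V f]; rewrite !inE => /and3P [_ _ /eqP <-].
Qed.

Definition nleaf X J B := #|[set f | [&& is_rtree (X, f),
  [forall v in J, is_leaf (X, f) v] & [forall v in B, ~~ is_leaf (X, f) v]]]|.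

(** The parent of v is any vertex outside J, since the members of J must remain leaves. *)
Lemma nleafD1 X J v : v \in J -> J \subset X -> X :\ v != set0 ->
  nleaf X J set0 = #|X :\: J| * nleaf (X :\ v) (J :\ v) set0.
Proof.
move=> vJ JX X0; have vX := subsetP JX v vJ.
pose Q (u : 'I_N * {ffun 'I_N -> 'I_N}) :=
  (u.1 \notin J) && [forall w in J :\ v, is_leaf (X :\ v, u.2) w].
have noB (Y : {set 'I_N}) f : [forall w in set0, ~~ is_leaf (Y, f) w] = true.
  by apply/forall_inP => w; rewrite inE.
transitivity #|[set f | [&& is_rtree (X, f), is_leaf (X, f) v & Q (f v, frestr (X :\ v) f)]]|.
  apply: eq_card => f; rewrite !in_set noB andbT; case: (boolP (is_rtree _)) => //= tf.
  apply/forall_inP/and3P => [lf|[/is_leafP lv fvJ /forall_inP lf] w wJ].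
    split; first exact: lf.
      have := leaf_not_root tf (lf v vJ) vX X0; rewrite !inE /= => /andP [fv _].
      by apply: contra fv => /lf /is_leafP /(_ v vX erefl) <-.
    apply/forall_inP => w /setD1P [_ wJ]; apply/is_leafP => x xW; rewrite /= ffunE xW.
    by have /setD1P [_ xX] := xW; have /is_leafP := lf w wJ; apply.
  apply/is_leafP => x xX fx; case: (w =P v) => [ewv|/eqP wv].
    by rewrite ewv; apply: lv; rewrite // fx.
  case: (x =P v) => [exv|/eqP xv]; first by rewrite /= -exv fx wJ in fvJ.
  have xW : x \in X :\ v by rewrite !inE xv.
  have wJv : w \in J :\ v by rewrite !inE wv.
  by have /is_leafP /(_ x xW) := lf w wJv; rewrite ffunE xW => /(_ fx).
rewrite card_leaf // /nleaf -cardsX; apply: eq_card => -[y h].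
rewrite in_set in_setX [h \in _]in_set noB andbT !in_setD in_set1 /Q /=.
have [->|_] := eqVneq y v; first by rewrite vJ.
by case: (y \in J); case: (y \in X); rewrite //= ?andbF.
Qed.

Local Open Scope ring_scope.

Lemma nleaf_ct X J n j : J \subset X -> #|X| = n.+1 -> #|J| = j.+1 ->
  (nleaf X J set0)%:R = ct (fD ^+ j * fL) n.
Proof.
have leafs0 Y : nleaf Y set0 set0 = tau #|Y|.
  rewrite -card_rtree; apply: eq_card => f; rewrite !in_set.
  case: (is_rtree _) => //=; apply/andP.
  by split; apply/forall_inP => w; rewrite inE.
elim: j n X J => [|j IH] n X J JX cX cJ.
  have /eqP/cards1P [v eJ] := cJ; rewrite expr0 mul1r fL_derT ctD ct1.
  have vX : v \in X by rewrite -sub1set -eJ.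
  (* On one vertex the root is a leaf, which is the term 1 of L = 1 + x T'; otherwise the leaf is
     detached. *)
  case: n cX => [|n] cX.
    have eX : X = [set v].
      by apply/esym/eqP; rewrite eqEcard sub1set vX cX cards1.
    have -> : nleaf X J set0 = tau #|X|.
      rewrite -leafs0; apply: eq_card => f; rewrite !in_set; case: (is_rtree _) => //=.
      congr (_ && _); apply/forall_inP/forall_inP => [_ w|_ w]; first by rewrite inE.
      by rewrite eJ inE => /eqP ->; apply/is_leafP => x; rewrite eX inE => /eqP.
    by rewrite cX /tau eps0 ctX0 addr0.
  have cXv : #|X :\ v| = n.+1 by move: cX; rewrite (cardsD1 v) vX => -[].
  rewrite (nleafD1 (v := v)) // ?eJ ?set11 ?sub1set // -?cards_eq0 ?cXv //.
  by rewrite setDv leafs0 cXv ctXS ct_der ct_egf add0r natrM mulr_natl.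
have [v vJ] : exists v, v \in J by apply/set0Pn; rewrite -card_gt0 cJ.
have vX := subsetP JX v vJ.
case: n cX => [|n] cX; first by have := subset_leq_card JX; rewrite cX cJ.
have cXv : #|X :\ v| = n.+1 by move: cX; rewrite (cardsD1 v) vX => -[].
have cJv : #|J :\ v| = j.+1 by move: cJ; rewrite (cardsD1 v) vJ => -[].
rewrite (nleafD1 (v := v)) // -?cards_eq0 ?cXv // natrM (IH n) ?setSD // fDL_rec.
have jn : (j <= n)%N by have := subset_leq_card JX; rewrite cX cJ !ltnS.
by rewrite cardsDS // cX cJ !subSS natrB.
Qed.

Lemma nleafU X J B v : v \in B ->
  (nleaf X J (B :\ v) = nleaf X J B + nleaf X (v |: J) (B :\ v))%N.
Proof.
move=> vB; rewrite /nleaf [RHS]addnC.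
rewrite -(cardsID [set f | is_leaf (X, f) v]); congr (_ + _)%N; apply: eq_card => f.
  rewrite !inE; case: (is_rtree _) => //=; rewrite andbAC; congr (_ && _).
  apply/andP/forall_inP => [[/forall_inP lf lv] w /setU1P [->//|/lf//]|lf].
  by split; [apply/forall_inP => w wJ|]; apply: lf; rewrite !inE ?eqxx ?wJ ?orbT.
rewrite !inE; case: (is_rtree _) => //=; rewrite ?andbF // andbCA; congr (_ && _).
apply/andP/forall_inP => [[lv /forall_inP lf] w wB|lf].
  by have [->//|wv] := eqVneq w v; apply: lf; rewrite !inE wv.
by split; [apply: lf | apply/forall_inP => w /setD1P [_ /lf]].
Qed.

(** Each nonleaf condition is the difference between no condition and a leaf condition, as M = 1 -
    D; induction on the size of B. *)
Lemma nleaf_nonleaf_ct X J B n j : J \subset X -> B \subset X -> [disjoint J & B] ->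
  #|X| = n.+1 -> #|J| = j.+1 -> (nleaf X J B)%:R = ct (fM ^+ #|B| * fD ^+ j * fL) n.
Proof.
move=> + + + cX; have [b eb] : exists b, #|B| = b by exists #|B|.
rewrite eb; elim: b j J B eb => [|b IH] j J B cB JX BX dis cJ.
  by rewrite (cards0_eq cB) expr0 mul1r; apply: nleaf_ct.
have [v vB] : exists v, v \in B by apply/set0Pn; rewrite -card_gt0 cB.
have cBv : #|B :\ v| = b by move: cB; rewrite (cardsD1 v) vB => -[].
have vJ : v \notin J by rewrite (disjointFl dis).
have BvX : B :\ v \subset X := subset_trans (subD1set _ _) BX.
have eN := nleafU X J vB.
have e1 := IH j J (B :\ v) cBv JX BvX (disjointWr (subD1set _ _) dis) cJ.
have e2 : (nleaf X (v |: J) (B :\ v))%:R = ct (fM ^+ b * fD ^+ j.+1 * fL) n.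
  apply: IH => //.
  - by rewrite subUset sub1set JX (subsetP BX).
  - rewrite -setI_eq0 setIUl setU_eq0 !setI_eq0 (disjointWr (subD1set _ _) dis) andbT.
    by rewrite disjoints1 !inE eqxx.
  - by rewrite cardsU1 vJ cJ.
have -> : fM ^+ b.+1 * fD ^+ j * fL = fM ^+ b * fD ^+ j * fL - fM ^+ b * fD ^+ j.+1 * fL.
  by rewrite !exprS /fD; ring.
by rewrite ctB -e1 -e2 eN natrD addrK.
Qed.

End Leaves.

(** * Maximal decreasing subtrees *)

Section MaximalDecreasing.
Variable N : nat.
Implicit Types (x y v r : 'I_N) (X S : {set 'I_N}) (f g h d : {ffun 'I_N -> 'I_N}).

Definition decr_on S f := [forall x in S, (f x != x) ==> (x < f x)].

Lemma decr_onP S f : reflect (forall x, x \in S -> f x != x -> x < f x) (decr_on S f).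
Proof.
apply: (iffP forall_inP) => H x xS; first by move/implyP: (H x xS).
by apply/implyP/H.
Qed.

Lemma decr_root_subtreeP X f S : reflect
  [/\ S \subset X, exists2 r, r \in roots X f & r \in S, stable S f & decr_on S f]
  (decr_root_subtree (X, f) S).
Proof.
apply: (iffP and4P) => /= -[SX rS Sf dS]; split=> //.
- by case/existsP: rS => r /andP [+ rS]; rewrite /is_root => rX; exists r; rewrite // inE.
- exact/forall_inP.
- by case: rS => r; rewrite inE => rX rS; apply/existsP; exists r; rewrite /is_root rX.
- exact/forall_inP.
Qed.

(** Decreasing subtrees containing the root are closed under union, so this union is MD itself. *)
Definition mdset X f := \bigcup_(S : {set 'I_N} | decr_root_subtree (X, f) S) S.

Lemma mdset_sup X f S : decr_root_subtree (X, f) S -> S \subset mdset X f.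
Proof. by move=> dS; apply: (bigcup_sup S). Qed.

Lemma mdset_decr X f : is_rtree (X, f) -> decr_root_subtree (X, f) (mdset X f).
Proof.
move=> /is_rtreeP [Xf [r er]]; apply/decr_root_subtreeP.
have /[!inE] /andP [rX /eqP fr] : r \in roots X f by rewrite er inE.
have dr : decr_root_subtree (X, f) [set r].
  apply/decr_root_subtreeP; split; first by rewrite sub1set.
  - by exists r; rewrite ?er set11.
  - by move=> x; rewrite !inE => /eqP ->; rewrite fr.
  - by apply/decr_onP => x; rewrite inE => /eqP ->; rewrite fr eqxx.
split.
- by apply/bigcupsP => S /decr_root_subtreeP [].
- by exists r; rewrite ?er ?set11 // (subsetP (mdset_sup dr)) ?set11.
- move=> x /bigcupP [S dS xS]; apply/bigcupP; exists S => //.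
  by case/decr_root_subtreeP: dS => _ _ sS _; apply: sS.
apply/decr_onP => x /bigcupP [S /decr_root_subtreeP [_ _ _ /decr_onP dS] xS].
exact: dS.
Qed.

Lemma MD_cardE X f m : is_rtree (X, f) -> (MD_card (X, f) m <-> #|mdset X f| = m).
Proof.
move=> tf; have dm := mdset_decr tf; split=> [[S /maxsetP [dS maxS] <-]|<-].
  by rewrite (maxS _ dm (mdset_sup dS)).
exists (mdset X f) => //; apply/maxsetP; split=> // S dS mS.
by apply/eqP; rewrite eqEsubset mdset_sup.
Qed.

Definition ndecr S := #|[set d | is_rtree (S, d) && decr_on S d]|.

(** The smallest vertex of a decreasing tree is a leaf and may hang from any other vertex; removing
    it gives the factorial recurrence. *)
Lemma ndecr_fact S n : #|S| = n.+1 -> ndecr S = n`!.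
Proof.
elim: n S => [|n IH] S cS.
  have /eqP/cards1P [v eS] := cS.
  apply: etrans (_ : tau #|S| = _); last by rewrite cS /tau eps0.
  rewrite -card_rtree; apply: eq_card => d; rewrite !in_set andb_idr // => tS.
  have [Sd _] := is_rtreeP _ _ tS; apply/decr_onP => x xS.
  by have := forest_stable Sd xS; move: xS; rewrite eS !inE => /eqP -> /eqP ->; rewrite eqxx.
have [x0 x0S] : exists x, x \in S by apply/set0Pn; rewrite -cards_eq0 cS.
case: (arg_minnP (P := mem S) val x0S) => v vS0 vmin; have vS : v \in S := vS0.
have vlt x : x \in S :\ v -> v < x.
  by move=> /setD1P [xv /vmin]; rewrite leq_eqVlt val_eqE eq_sym (negPf xv).
have cSv : #|S :\ v| = n.+1 by move: cS; rewrite (cardsD1 v) vS => -[].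
have S0 : S :\ v != set0 by rewrite -cards_eq0 cSv.
pose Q (u : 'I_N * {ffun 'I_N -> 'I_N}) := decr_on (S :\ v) u.2.
transitivity #|[set d | [&& is_rtree (S, d), is_leaf (S, d) v & Q (d v, frestr (S :\ v) d)]]|.
  apply: eq_card => d; rewrite !in_set; case: (boolP (is_rtree _)) => //= td.
  apply/decr_onP/andP => [dec|[lv /decr_onP dec] x xS dx].
    split.
      apply/is_leafP => x xS dx; apply/eqP/negPn/negP => xv.
      have := dec x xS; rewrite dx eq_sym xv => /(_ isT).
      by rewrite ltnNge vmin.
    by apply/decr_onP => x xS; rewrite ffunE xS; apply: dec; case/setD1P: xS.
  have [->|xv] := eqVneq x v; first exact/vlt/(leaf_not_root td).
  have xSv : x \in S :\ v by rewrite !inE xv.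
  by have := dec x xSv; rewrite ffunE xSv; apply.
rewrite card_leaf // factS -(IH _ cSv) -cSv /ndecr -cardsX; apply: eq_card => -[y h].
by rewrite in_set in_setX [h \in _]in_set.
Qed.

(** Minimal rootedness stops MD at the roots of g: no edge of MD can enter a root of g from below,
    so a vertex of MD outside S would never reach S, although its orbit under g ends there. *)
Lemma mdset_glue X g d : forest X g -> min_rooted (X, g) ->
  is_rtree (roots X g, d) -> decr_on (roots X g) d ->
  let f := fglue (roots X g) d g in is_rtree (X, f) /\ mdset X f = roots X g.
Proof.
move=> Xg /min_rootedP mg td dd; set S := roots X g => f.
have [Sd [r er]] := is_rtreeP _ _ td.
have [oX sX [rg rkg]] := forestP _ _ Xg; have [_ sS [rd rkd]] := forestP _ _ Sd.
have SX : S \subset X by apply/subsetP => x; rewrite inE => /andP [].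
have tf : is_rtree (X, f).
  apply/is_rtreeP; split.
    apply/forestP; split=> [x xX|x xX|].
    + by rewrite ffunE ifN ?oX //; apply: contra xX; apply: (subsetP SX).
    + by rewrite ffunE; case: ifPn => [/sS /(subsetP SX)//|_]; apply: sX.
    (* Edges may lead from outside S into S, so outside ranks are lifted above all ranks of [d]. *)
    pose B := \max_x rd x.
    exists (fun x => if x \in S then rd x else B.+1 + rg x) => x; rewrite ffunE.
    case: ifPn => [xS|xS] ne; first by rewrite sS // rkd.
    case: ifPn => _; last by rewrite ltn_add2l rkg.
    by rewrite addSn ltnS (leq_trans (leq_bigmax (g x))) // leq_addr.
  exists r; rewrite -er; apply/setP => x; rewrite !inE ffunE.
  case: (boolP (x \in S)) => [/[dup] xS /(subsetP SX) xX|xS].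
    by move: xS; rewrite !inE xX /= => ->.
  by move: xS; rewrite !inE => /negPf ->.
split=> //; have rS : r \in S by have := set11 r; rewrite -er inE => /andP [].
have fS x : x \in S -> f x = d x by move=> xS; rewrite ffunE xS.
have dS : decr_root_subtree (X, f) S.
  apply/decr_root_subtreeP; split=> //.
  - exists r; rewrite // inE (subsetP SX) // fS //.
    by have := set11 r; rewrite -er inE => /andP [].
  - by move=> x xS; rewrite fS // sS.
  - by apply/decr_onP => x xS; rewrite fS // => ne; apply: (decr_onP _ _ dd).
apply/eqP; rewrite eqEsubset mdset_sup // andbT.
have /decr_root_subtreeP [MX _ sM /decr_onP dM] := mdset_decr tf.
apply/subsetP => x xM; apply/negPn/negP => xS.
have sW : stable (mdset X f :\: S) g.
  move=> y /setDP [yM yS]; have fy : f y = g y by rewrite ffunE (negPf yS).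
  rewrite inE -[X in X \in mdset _ _]fy sM // andbT; apply/negP => gS.
  have yX := subsetP MX y yM.
  have /[!inE] /andP [gX /eqP gg] := gS.
  have gy : g y != y by apply: contra yS => /eqP e; rewrite inE yX e eqxx.
  have := mg (g y) y gX gg yX erefl; rewrite eq_sym gy => /(_ isT).
  by rewrite ltnNge ltnW // -fy dM // fy.
have xW : x \in mdset X f :\: S by rewrite inE xS.
have /setDP [_] := iter_stable N sW xW.
by rewrite (top_roots Xg (subsetP MX x xM)).
Qed.

Lemma mdset_cut X f : is_rtree (X, f) ->
  let S := mdset X f in let g := [ffun x => if x \in S then x else f x] in
  [/\ forest X g, roots X g = S, min_rooted (X, g), is_rtree (S, frestr S f)
    & decr_on S (frestr S f)].
Proof.
move=> tf S g; have [Xf [r er]] := is_rtreeP _ _ tf.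
have /decr_root_subtreeP [SX [r' rX' rS] sS /decr_onP dS] := mdset_decr tf.
have er' : r' = r by apply/eqP; rewrite -in_set1 -er.
subst r'; have [oX sX [rk rkf]] := forestP _ _ Xf.
have Sf := forest_restr Xf sS.
have eS : roots S (frestr S f) = [set r].
  by rewrite (roots_restr _ SX) er; apply/setIidPl; rewrite sub1set.
have eg : roots X g = S.
  apply/setP => x; rewrite !inE ffunE; case: ifPn => [xS|xS].
    by rewrite eqxx (subsetP SX).
  apply/negbTE/negP => fx; have : x \in roots X f by rewrite inE.
  by rewrite er inE => /eqP e; rewrite e rS in xS.
split=> //.
- apply/forestP; split=> [x xX|x xX|].
  + by rewrite ffunE oX // if_same.
  + by rewrite ffunE; case: ifP => // _; apply: sX.
  + by exists rk => x; rewrite ffunE; case: ifP => [_|_ /rkf//]; rewrite eqxx.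
- apply/min_rootedP => s x sX' gs xX gx xs.
  have sS' : s \in S by rewrite -eg inE sX' gs eqxx.
  have xS : x \notin S.
    by apply/negP => xS; move: gx; rewrite ffunE xS => e; rewrite e eqxx in xs.
  have fx : f x = s by move: gx; rewrite ffunE (negPf xS).
  rewrite ltn_neqAle val_eqE eq_sym xs leqNgt; apply/negP => xlts.
  (* A child smaller than its parent in S could be added to S, against maximality. *)
  have : decr_root_subtree (X, f) (x |: S).
    apply/decr_root_subtreeP; split.
    + by rewrite subUset sub1set xX.
    + by exists r; rewrite // inE rS orbT.
    + by move=> y; rewrite !inE => /predU1P [->|/sS ->]; rewrite ?fx ?sS' orbT.
    + apply/decr_onP => y; rewrite !inE => /predU1P [->|/dS//]; by rewrite fx.
  by move=> /mdset_sup /subsetP /(_ x); rewrite !inE eqxx (negPf xS) => /(_ isT).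
- by apply/is_rtreeP; split=> //; exists r.
- by apply/decr_onP => x xS; rewrite ffunE xS; apply: dS.
Qed.

(** Cutting the edges inside MD leaves a forest of minimally rooted trees rooted at the vertices of
    MD; the cut edges form one of m! decreasing trees on these roots. *)
Lemma card_mdset X m :
  #|[set f | is_rtree (X, f) && (#|mdset X f| == m.+1)]| = m`! * nminf m.+1 X.
Proof.
transitivity (\sum_(g | [&& forest X g, #|roots X g| == m.+1 & min_rooted (X, g)])
    #|[set d | is_rtree (roots X g, d) && decr_on (roots X g) d]|); last first.
  rewrite /nminf mulnC -sum_nat_const; apply: eq_big => [g|g /and3P [_ /eqP cg _]].
    by rewrite inE.
  exact: ndecr_fact.
rewrite sum_card_pair.
apply: (@card_bij _ _ _ _
  (fun f => ([ffun x => if x \in mdset X f then x else f x], frestr (mdset X f) f))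
  (fun u => fglue (roots X u.1) u.2 u.1)).
- move=> f; rewrite in_set => /andP [tf cf]; rewrite in_set /=.
  by have [-> -> -> -> ->] := mdset_cut tf; rewrite cf.
- move=> [g d]; rewrite [(g, d) \in _]in_set /= => /andP [/and3P [Xg cg mg] /andP [td dd]].
  by rewrite ?in_set /=; have [-> ->] := mdset_glue Xg mg td dd.
- move=> f; rewrite in_set => /andP [tf _] /=; have [_ -> _ _ _] := mdset_cut tf.
  by apply/ffunP => x; rewrite !ffunE; case: (x \in mdset X f).
- move=> [g d]; rewrite [(g, d) \in _]in_set /= => /andP [/and3P [Xg cg mg] /andP [td dd]].
  have [_ ->] := mdset_glue Xg mg td dd; congr (_, _); apply/ffunP => x; rewrite !ffunE.
    case: (boolP (x \in roots X g)) => // xS; move: (xS).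
    by rewrite inE => /andP [_ /eqP].
  case: ifPn => xS; rewrite ?xS //; have [Sd _] := is_rtreeP _ _ td.
  by rewrite (forest_out Sd).
Qed.

Local Open Scope ring_scope.

Lemma nminf_ct j X : (j`! * nminf j X)%N%:R = ct (fM ^+ j) #|X|.
Proof.
elim: j X => [|j IH] X; first by rewrite nminf0 mul1n expr0 ct1 cards_eq0.
rewrite factS mulnAC -sum_min_nminf natrM natr_sum.
rewrite exprS -sum_subsets_ct -(sum_tree_ct (P := @min_rooted N) (fun V => V \subset X)
  (fun V => ct (fM ^+ j) #|X :\: V|) (@ntree_min_mu N)).
by rewrite mulr_suml; apply: eq_bigr => t _; rewrite -natrM mulnC IH.
Qed.

Lemma card_mdset_ct X m n : #|X| = n.+1 ->
  (#|[set f | is_rtree (X, f) && (#|mdset X f| == m.+1)%N]|)%:R = ct (fM ^+ m * fL) n.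
Proof.
move=> cX; have := nminf_ct m.+1 X.
rewrite cX -ct_der fderXn fder_M ctMn factS -mulnA natrM mulr_natl card_mdset => /eqP.
by rewrite Num.Theory.eqr_pMn2r // => /eqP.
Qed.

End MaximalDecreasing.

Lemma card_iv N m : m < N -> #|iv N m| = m.
Proof.
elim: m => [|m IH] mN.
  by apply/eqP; rewrite cards_eq0; apply/eqP/setP => i; rewrite !inE; case: (val i).
have -> : iv N m.+1 = Ordinal mN |: iv N m.
  apply/setP => i; rewrite !inE -val_eqE /= [i <= m.+1]leq_eqVlt ltnS.
  by case: eqP => [->|] //=.
by rewrite cardsU1 IH 1?ltnW // !inE /= ltnn.
Qed.

Lemma cmod_fin (T : finType) (P : T -> Prop) (p : pred T) :
  (forall x, P x <-> p x) -> cmod P (#|[set x | p x]|%:R)%R.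
Proof.
move=> Pp; exists #|[set x | p x]| => //; exists (enum [set x | p x]); split.
- by rewrite -cardE.
- exact: enum_uniq.
- by move=> x; rewrite mem_enum inE => /Pp.
- by [].
by move=> x /Pp px; exists x; rewrite // mem_enum inE.
Qed.

(** * The five cardinalities *)

Section Main.
Variables n k : nat.
Hypothesis kn : k <= n.
Local Notation X := (iv n.+2 n.+1).
Local Notation q := (ct (fM ^+ k * fL)%R n).

Let cX : #|X| = n.+1. Proof. exact: card_iv. Qed.
Let maxX : ord_max \in X. Proof. by rewrite inE /= leqnn. Qed.

Lemma cmod_Tset : cmod (Tset n k) q.
Proof.
rewrite -(card_mdset_ct k cX).
apply: (cmod_image (P := fun f => is_rtree (X, f) && (#|mdset X f| == k.+1))
  (phi := fun f => (X, f))); last exact: cmod_fin.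
  by move=> f g _ _ [].
move=> [V f]; split=> [[tf eV md]|[g /andP [tg /eqP mg] [-> ->]]].
  by rewrite /= in eV; subst V; exists f => //; rewrite tf; apply/eqP/(MD_cardE _ tf).
by split=> //; apply/MD_cardE.
Qed.

(** Each cycle has exactly one rotation whose first tree contains n + 1; these rotations serve as
    representatives. *)
Lemma card_mod_Aset c : (c%:R = q)%R -> card_mod (Aset n k) rot_equiv c.
Proof.
have := @cmod_minlist_in _ k X _ maxX; rewrite cX /=.
move=> mc cq; have [s [sc us sP _ cov]] := cmod_card mc cq.
have AP u : minlist k.+1 X u <-> Aset n k u.
  by split=> [/and4P [/eqP]|[/eqP su tu mu pu]] //; apply/and4P.
exists s; split=> // [u /sP [/AP]//|u v /sP [pu [t [u' [eu xt]]]] /sP [_ [t' [v' [ev xt']]]] [i ei]|u].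
  case: (posnP i) => [i0|i0]; first by rewrite ei i0 rot0.
  case: (leqP (size u) i) => [iu|iu]; first by rewrite ei rot_oversize.
  have /and4P [_ _ _ ps] := pu.
  (* Tree number i comes first after the rotation, so it contains n + 1 as tree 0 does; disjointness
     forces i = 0. *)
  have hi : nth t u i = t'.
    have := congr1 (head t) ei; rewrite ev /= => ->.
    by rewrite -nth0 /rot nth_cat size_drop subn_gt0 iu nth_drop addn0.
  have := seq_partition_nth (i := 0) (j := i) (x := ord_max) ps.
  rewrite !size_map iu (ltn_trans i0 iu) !(nth_map t) ?(ltn_trans i0 iu) // hi.
  by rewrite eu /= xt xt' => /(_ isT isT isT isT) i0'; rewrite -i0' in i0.
move=> /AP pu; have /and4P [/eqP su tu mu ps] := pu.
have [i iu xi] : exists2 i, i < size u & forall t, ord_max \in (nth t u i).1.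
  have : ord_max \in \bigcup_(V <- [seq t.1 | t <- u]) V by have /and3P [/eqP -> _ _] := ps.
  elim: (u) => [|t v IH] /=; first by rewrite big_nil inE.
  rewrite big_cons inE => /orP [xt|/IH [i iv xi]]; first by exists 0.
  by exists i.+1.
have pr : minlist k.+1 X (rot i u).
  by apply/and4P; rewrite size_rot su !(eq_all_r (mem_rot i u)) map_rot seq_partition_rot.
have [v vs ev] : exists2 v, v \in s & rot i u = v.
  apply: cov; split=> //; exists (nth (set0, [ffun x => x]) u i).
  by exists (drop i.+1 u ++ take i u); rewrite /rot (drop_nth (set0, [ffun x => x])).
by exists v => //; exists i.
Qed.

Lemma cmod_Bset : cmod (Bset n k) q.
Proof.
have := cmod_blist k (iv n.+2 n); rewrite card_iv //; apply: cmod_ext => s.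
split=> [/and4P [ks ts ps ms]|[ks /andP [ts ps] ms]]; last by apply/and4P.
by split=> //; apply/andP.
Qed.

(** Start at height 0 with no unread trees; as k <= n, exactly k vertices of [n] are special, so the
    exponent is k. *)
Lemma cmod_Cset : cmod (Cset n k) q.
Proof.
have := cmod_cstate (iv n.+2 k) (iv n.+2 n) 0; rewrite card_iv // addn0.
have -> : iv n.+2 n :&: iv n.+2 k = iv n.+2 k.
  apply/setIidPr/subsetP => x; rewrite !inE => /andP [-> /leq_trans]; exact.
rewrite card_iv; last by rewrite ltnS leqW.
have nil1 u : cstate (iv n.+2 k) (iv n.+2 n) 0 u -> u.1 = [::] by case/and4P; case: u.1.
apply: (cmod_image (phi := snd)) => [[s Fs] [s' Fs'] /nil1 /= -> /nil1 /= -> -> //|Fs].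
split=> [[gF pF]|[[s Fs'] cs ->]].
  by exists ([::], Fs); rewrite // -Cset_flatten gF.
have s0 := nil1 _ cs; rewrite /= in s0; subst s.
by move: cs; rewrite -Cset_flatten => /andP.
Qed.

(** One prescribed leaf, n + 1, means j = 0, so no factor D remains; k <= n keeps it apart from the
    k prescribed nonleaves. *)
Lemma cmod_Fset : cmod (Fset n k) q.
Proof.
have Jdis : [disjoint [set ord_max] & iv n.+2 k].
  by rewrite disjoints1 inE /= -ltnNge ltnS.
have ivX : iv n.+2 k \subset X.
  by apply/subsetP => x; rewrite !inE => /andP [-> /leq_trans]; apply; apply: leqW.
have := nleaf_nonleaf_ct (J := [set ord_max]) (j := 0) _ ivX Jdis cX (cards1 _).
rewrite sub1set => /(_ maxX); rewrite expr0 mulr1 card_iv 1?ltnS 1?leqW // => <-.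
apply: (cmod_image (phi := fun f => (X, f))); last by apply: cmod_fin => f; apply: iff_refl.
  by move=> f g _ _ [].
move=> [V f]; split=> [[tf eV lm nl]|[g /and3P [tg /forall_inP lg /forall_inP ng] [-> ->]]].
  rewrite /= in eV; subst V; exists f => //; apply/and3P; split=> //.
    by apply/forall_inP => v; rewrite inE => /eqP ->.
  by apply/forall_inP => v; rewrite inE => /nl.
split=> //; first by apply: lg; rewrite inE.
by move=> v vk; apply: ng; rewrite inE.
Qed.

End Main.

Theorem theorem1p3 (n k : nat) (hkn : k <= n) :
  exists c : nat,
    [/\ card_mod (Tset n k) eq c,
        card_mod (Aset n k) rot_equiv c,
        card_mod (Bset n k) eq c,
        card_mod (Cset n k) eq c &
        card_mod (Fset n k) eq c].
Proof.
have [c Bc cq] := cmod_Bset n k; exists c; split=> //.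
- exact: cmod_card (cmod_Tset n k) cq.
- exact: card_mod_Aset cq.
- exact: cmod_card (cmod_Cset hkn) cq.
- exact: cmod_card (cmod_Fset hkn) cq.
Qed.
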